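(* Let $\Omega\subset\mathbb{R}^n\times\mathbb{R}$ be a bounded domain, let $\zeta_0=(x_0,t_0)\in\partial\Omega$, and set $\Omega_-=\{(x,t)\in\Omega: t<t_0\}$. Then $\zeta_0$ is a regular boundary point of $\Omega$ if and only if either $\zeta_0$ is a regular boundary point of $\Omega_-$, or $\zeta_0\notin\partial\Omega_-$. (Regularity is with respect to the normalised $\infty$-heat equation $u_t-\Delta_\infty^N u=0$.)
   Context: The notions below are for a bounded open set $G\subset\mathbb{R}^n\times\mathbb{R}$ (applied with $G=\Omega$ and $G=\Omega_-$). Points are written $\zeta=(x,t)$; $D$ and $D^2$ are the gradient and Hessian in the spatial variable $x$ only; $\partial G$ is the Euclidean boundary in $\mathbb{R}^{n+1}$. For $D\psi\ne0$, $\Delta_\infty^N\psi=\frac{1}{|D\psi|^2}\sum_{i,j=1}^n\psi_{x_i}\psi_{x_j}\psi_{x_ix_j}$. For a symmetric matrix $X$, $\Lambda(X)$ is its largest eigenvalue. An upper semicontinuous $u:G\to\mathbb{R}\cup\{-\infty\}$ is a (viscosity) subsolution in $G$ if for every $\psi\in C^2(G)$ such that $u-\psi$ has a maximum at $\zeta_0\in G$ one has $\psi_t(\zeta_0)-\Delta_\infty^N\psi(\zeta_0)\le0$ if $D\psi(\zeta_0)\neq0$, and $\psi_t(\zeta_0)-\Lambda(D^2\psi(\zeta_0))\le0$ if $D\psi(\zeta_0)=0$. Lower Perron solution: for $f:\partial G\to\mathbb{R}$ continuous, the lower class $\mathcal{L}_f$ consists of all subsolutions $v$ in $G$ with $\limsup_{\eta\to\zeta,\,\eta\in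 G}v(\eta)\le f(\zeta)$ for all $\zeta\in\partial G$, and $\underline{H}_f(\zeta)=\sup\{v(\zeta):v\in\mathcal{L}_f\}$ for $\zeta\in G$. Regular point: $\zeta_0\in\partial G$ is a regular boundary point of $G$ if $\lim_{\zeta\to\zeta_0,\,\zeta\in G}\underline{H}_f(\zeta)=f(\zeta_0)$ for every continuous $f:\partial G\to\mathbb{R}$. *)

(* Defs.v *)
From HB Require Import structures.
From mathcomp Require Import all_boot all_order all_algebra.
From mathcomp Require Import all_classical all_reals all_analysis.

Set Implicit Arguments.
Unset Strict Implicit.
Unset Printing Implicit Defensive.

Import Order.TTheory GRing.Theory Num.Theory.
Import numFieldNormedType.Exports.

Local Open Scope classical_set_scope.
Local Open Scope ring_scope.

(* Functions on a set [G] (or on its boundary) are represented by total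
   functions; only their values on [G] (resp. on its boundary) are used below. *)

Definition boundary (T : topologicalType) (A : set T) : set T :=
  closure A `\` interior A.

Section NormalisedInfinityHeat.
Context {R : realType} {n : nat}.

Notation pt := ('rV[R]_n * R)%type.

Implicit Types (G : set pt) (psi : pt -> R) (u v : pt -> \bar R) (f : pt -> R).

Definition space_dir (i : 'I_n) : pt := (delta_mx 0 i, 0).
Definition time_dir : pt := (0, 1).

Definition coord_dir (k : option 'I_n) : pt :=
  if k is Some i then space_dir i else time_dir.

(* The derivatives in [t], including the second-order and mixed ones, are
   covered: [coord_dir] runs over all n + 1 coordinate directions. *)
Definition C2_on G psi :=
  [/\ {within G, continuous psi},
      (forall k, (forall z, G z -> derivable psi z (coord_dir k)) /\
        {within G, continuous ('D_(coord_dir k) psi)}) &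
      (forall k l,
        (forall z, G z -> derivable ('D_(coord_dir k) psi) z (coord_dir l)) /\
        {within G, continuous ('D_(coord_dir l) ('D_(coord_dir k) psi))})].

Definition time_deriv psi (z : pt) : R := 'D_time_dir psi z.

Definition grad psi (z : pt) : 'rV[R]_n :=
  \row_(i < n) 'D_(space_dir i) psi z.

Definition hess psi (z : pt) : 'M[R]_n :=
  \matrix_(i < n, j < n) 'D_(space_dir j) ('D_(space_dir i) psi) z.

(* The squared norm of the gradient is written out because the norm of ['rV_n]
   in the library is the sup norm. *)
Definition infty_laplace psi (z : pt) : R :=
  (\sum_(i < n) (grad psi z 0 i) ^+ 2)^-1 *
  \sum_(i < n) \sum_(j < n)
    grad psi z 0 i * grad psi z 0 j * hess psi z i j.

(* For symmetric [X] of positive size the set of eigenvalues is finite and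
   nonempty, so that this supremum is the largest one. *)
Definition max_eigenvalue (X : 'M[R]_n) : R := sup [set a | eigenvalue X a].

Definition usc_on G u :=
  forall z, G z -> forall a : R, (u z < a%:E)%E ->
    \forall y \near within G (nbhs z), (u y < a%:E)%E.

Definition subsolution G u :=
  [/\ forall z, G z -> (u z < +oo)%E,
      usc_on G u &
      forall psi z0, C2_on G psi -> G z0 ->
        (forall z, G z -> (u z - (psi z)%:E <= u z0 - (psi z0)%:E)%E) ->
        (grad psi z0 != 0 -> time_deriv psi z0 - infty_laplace psi z0 <= 0) /\
        (grad psi z0 = 0 ->
           time_deriv psi z0 - max_eigenvalue (hess psi z0) <= 0)].

Definition lower_class G f : set (pt -> \bar R) :=
  [set v | subsolution G v /\
     forall z, boundary G z ->
       (limf_esup v (within G (nbhs z)) <= (f z)%:E)%E].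

Definition lower_perron G f (z : pt) : \bar R :=
  ereal_sup [set v z | v in lower_class G f].

Definition regular_boundary_point G (z0 : pt) :=
  boundary G z0 /\
  forall f, {within boundary G, continuous f} ->
    lower_perron G f z @[z --> within G (nbhs z0)] --> (f z0)%:E.

Definition before (t0 : R) G : set pt := [set z | G z /\ z.2 < t0].

End NormalisedInfinityHeat.

(* Main.v *)
Require Import Defs.
From HB Require Import structures.
From mathcomp Require Import all_boot all_order all_algebra.
From mathcomp Require Import all_classical all_reals all_analysis.
From mathcomp Require Import ring lra.
Import Order.TTheory GRing.Theory Num.Theory.
Import numFieldNormedType.Exports.
Local Open Scope classical_set_scope.
Local Open Scope ring_scope.

(** Let phi = |x - x0|^2 + c (t - t0)^2 with c so small that -A phi is a strict
    supersolution and A phi a subsolution on Omega.  With boundary data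
    f(z0) -+ e -+ A phi, the Perron solutions of Omega and of Omega_- can be
    compared: subsolutions of Omega restrict to Omega_-, and a subsolution v
    of Omega_- extends to Omega as max (v - delta / (t0 - t), w), since the
    penalisation sends the first function to -oo as t increases to t0.

    Conversely, control on Omega_- near z0 propagates to times t >= t0 through
    the barrier P = a |x - x0|^2 + (2a + 2) (t - t0) + C (t - t0)^2 with C
    large: f(z0) + P is a strict supersolution except where t <= t0 - 1/C,
    hence only inside Omega_-; P is at least -e, and large away from z0.  The
    lower bound uses the upper semicontinuous envelope of a Perron family on
    Omega_-, which is itself a subsolution. *)

(** Subsolutions are tested at global maxima by functions that are C2 on the whole set. So
    restriction to Omega_- is a genuine step, and every perturbed test function must keep its
    maximum global. The operator is discontinuous where the gradient vanishes, and a general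
    comparison principle would have to face this. It is avoided: subsolutions are compared only with
    functions a |x - x0|^2 + h(t). Their spatial Hessian is 2a times the identity, both branches of
    the operator give 2a, and only the sign of h' - 2a matters. The delicate part of the boundary of
    Omega_- consists of the points of Omega at time t0, where data on the boundary of Omega say
    nothing; there one uses either a barrier bound or the penalisation. The envelope is needed
    because regularity gives a large member of the lower class at each point separately, while
    gluing asks for one subsolution that is large throughout Omega_- near z0. *)

(** * Directional derivatives: mean values along lines, mixed derivatives, local maxima *)

Section Lines.
Set Implicit Arguments.
Unset Strict Implicit.
Context {R : realType} {V : normedModType R}.
Implicit Types (f : V -> R) (y z v w : V).

Lemma is_derive_line f y v (t d : R) :
  is_derive (t *: v + y) v f d -> is_derive t 1 (fun s : R => f (s *: v + y)) d.
Proof.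
have E : (fun h : R => h^-1 *: ((f \o shift (t *: v + y)) (h *: v) - f (t *: v + y)))
   = (fun h : R => h^-1 *: (((fun s : R => f (s *: v + y)) \o shift t) (h *: 1) -
        f (t *: v + y))).
  by apply/funext => h /=; rewrite [_%:A]mulr1 scalerDl addrA.
by case=> df <-; split; [move: df; rewrite /derivable E|rewrite /derive E].
Qed.

Lemma near_plane (P : V -> Prop) z v w : (\forall y \near z, P y) ->
  exists2 r : R, 0 < r &
    forall a b : R, `|a| <= r -> `|b| <= r -> P (a *: v + (b *: w + z)).
Proof.
move=> /nbhs_ballP[e e0 He].
pose r := e / (2 * (`|v| + `|w| + 1)).
have s0 : 0 < `|v| + `|w| + 1 by rewrite ltr_wpDl// addr_ge0.
have r0 : 0 < r by rewrite divr_gt0// mulr_gt0.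
exists r => // a b ar br; apply: He.
rewrite -ball_normE /ball_ /= -normrN opprB addrA addrK.
rewrite (le_lt_trans (ler_normD _ _))// !normrZ.
have : `|a| * `|v| + `|b| * `|w| <= r * (`|v| + `|w| + 1).
  rewrite 2!mulrDr mulr1 -addrA lerD ?ler_wpM2r//.
  by rewrite (le_trans (ler_wpM2r _ br))// lerDl ltW.
move=> /le_lt_trans; apply.
rewrite /r invfM mulrA divfK ?gt_eqF//.
by rewrite ltr_pdivrMr// ltr_pMr// ltr1n.
Qed.

Lemma line_mean_value f y v (s : R) :
  (forall t : R, `|t| <= `|s| -> derivable f (t *: v + y) v) ->
  exists2 t, `|t| <= `|s| & f (s *: v + y) - f y = s * 'D_v f (t *: v + y).
Proof.
move=> df; pose g (t : R) := f (t *: v + y); pose dg t := 'D_v f (t *: v + y).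
have g' (t : R) : `|t| <= `|s| -> is_derive t 1 g (dg t).
  by move=> /df ?; apply/is_derive_line/derivableP.
have cg (a b : R) : (forall t : R, t \in `[a, b]%R -> `|t| <= `|s|) ->
    {within `[a, b], continuous g}.
  move=> H; apply: derivable_within_continuous => t /H/g' ?; exact: ex_derive.
have E0 : f y = g 0 by rewrite /g scale0r add0r.
rewrite E0 -/(g s); case: (lerP 0 s) => s0.
  have H (t : R) : t \in `[0, s]%R -> `|t| <= `|s|.
    by rewrite in_itv/= => /andP[t0 ts]; rewrite !ger0_norm.
  have [t ts||t /H ts] := @MVT_segment R g dg 0 s s0.
  - by apply: g'; apply: H; exact: subset_itv_oo_cc.
  - exact: cg.
  by rewrite subr0 mulrC => ->; exists t.
have H (t : R) : t \in `[s, 0]%R -> `|t| <= `|s|.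
  by rewrite in_itv/= => /andP[t0 ts]; rewrite !ler0_norm ?(ltW s0)// lerN2.
have [t ts||t /H ts] := @MVT_segment R g dg s 0 (ltW s0).
- by apply: g'; apply: H; exact: subset_itv_oo_cc.
- exact: cg.
rewrite sub0r => e; exists t => //.
by rewrite -opprB e mulrN opprK mulrC.
Qed.

End Lines.

Section Directional.
Set Implicit Arguments.
Unset Strict Implicit.
Context {R : realType} {V : normedModType R}.
Implicit Types (f : V -> R) (y z v w : V).

(** Clearing the denominator admits s = 0 and turns derivative rules into triangle inequalities. *)
Lemma is_derive_epsP f z v (d : R) :
  is_derive z v f d <->
  forall e : R, 0 < e -> exists2 r : R, 0 < r &
    forall s : R, `|s| < r -> `|f (s *: v + z) - f z - s * d| <= e * `|s|.
Proof.
split=> [[df <-] e e0|H].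
  have /cvgrPdist_le/(_ e e0) := df.
  rewrite -nbhs_nearE => /nbhs_ballP[r /= r0 Hr]; exists r => // s sr.
  have [->|s0] := eqVneq s 0.
    by rewrite scale0r add0r subrr mul0r subr0 !normr0 mulr0.
  have /= := Hr s; rewrite -ball_normE /ball_/= sub0r normrN => /(_ sr s0).
  rewrite -/(derive f z v) => K.
  have -> : f (s *: v + z) - f z - s * 'D_v f z =
     - (s * ('D_v f z - s^-1 *: (f (s *: v + z) - f z))).
    by rewrite mulrBr -[s^-1 *: _]/(s^-1 * _) mulrA mulfV// mul1r opprB.
  by rewrite normrN normrM mulrC ler_wpM2r.
have cv : (fun h : R => h^-1 *: ((f \o shift z) (h *: v) - f z)) @ 0^' --> d.
  apply/cvgrPdist_le => e e0; have [r r0 Hr] := H e e0.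
  rewrite -nbhs_nearE; apply/nbhs_ballP; exists r => // s /=.
  rewrite -ball_normE /ball_/= sub0r normrN => sr s0.
  have := Hr s sr.
  have -> : f (s *: v + z) - f z - s * d =
     - (s * (d - s^-1 *: (f (s *: v + z) - f z))).
    by rewrite mulrBr -[s^-1 *: _]/(s^-1 * _) mulrA mulfV// mul1r opprB.
  by rewrite normrN normrM mulrC ler_pM2r// normr_gt0.
by split; [apply/cvg_ex; exists d|exact/cvg_lim].
Qed.

(* The increment along v is taken from the displaced point s w + z by the mean
   value theorem, so that continuity is needed for the derivative along v only. *)
Lemma is_derive_dirD f z v w (dw : R) :
  (\forall y \near z, derivable f y v) -> {for z, continuous ('D_v f)} ->
  is_derive z w f dw -> is_derive z (v + w) f ('D_v f z + dw).
Proof.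
move=> df cf /is_derive_epsP dfw; apply/is_derive_epsP => e e0.
have e20 : 0 < e / 2 by rewrite divr_gt0.
have [r1 r10 H1] := dfw _ e20.
have /cvgrPdist_le/(_ _ e20) cf' := cf.
have [r2 r20 H2] := near_plane v w (filterI df cf').
exists (Num.min r1 r2); first by rewrite lt_min r10.
move=> s; rewrite lt_min => /andP[s1 s2].
have [t ts E] : exists2 t, `|t| <= `|s| & f (s *: v + (s *: w + z)) - f (s *: w + z)
     = s * 'D_v f (t *: v + (s *: w + z)).
  apply: line_mean_value => t ts; apply: (H2 _ _ _ _).1; last exact: ltW.
  exact: (le_trans ts (ltW s2)).
have K := (H2 t s (le_trans ts (ltW s2)) (ltW s2)).2.
rewrite scalerDr -(addrA (s *: v)).
have -> : f (s *: v + (s *: w + z)) - f z - s * ('D_v f z + dw) =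
  - (s * ('D_v f z - 'D_v f (t *: v + (s *: w + z)))) +
   (f (s *: w + z) - f z - s * dw).
  move: E; move: (f (s *: v + _)) (f (s *: w + z)) (f z) ('D_v f _) ('D_v f _).
  by move=> a b c d1 d2 E; lra.
rewrite (le_trans (ler_normD _ _))// normrN normrM.
rewrite (splitr e) mulrDl lerD// ?H1//.
by rewrite mulrC ler_wpM2r.
Qed.

Lemma is_derive_dirZ f z v (c d : R) :
  is_derive z v f d -> is_derive z (c *: v) f (c * d).
Proof.
move=> /is_derive_epsP H; apply/is_derive_epsP => e e0.
have [->|c0] := eqVneq c 0.
  exists 1 => // s _; rewrite scale0r scaler0 add0r subrr mul0r mulr0 subr0 normr0.
  by rewrite mulr_ge0// ltW.
have nc : 0 < `|c| by rewrite normr_gt0.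
have [r r0 Hr] := H (e / `|c|) (divr_gt0 e0 nc).
exists (r / `|c|); first by rewrite divr_gt0.
move=> s sr; rewrite scalerA mulrA.
rewrite (le_trans (Hr _ _))//; first by rewrite normrM -ltr_pdivlMr.
by rewrite normrM mulrA mulrAC divfK ?gt_eqF.
Qed.

(** The second difference of [f] over a small parallelogram is symmetric in the two directions. Two
    mean values, taken in either order, express it by each mixed derivative at some nearby point;
    continuity then closes the gap at [z]. *)
Lemma second_derivativeC f z v w :
  (\forall y \near z, derivable f y v /\ derivable f y w) ->
  (\forall y \near z, derivable ('D_v f) y w /\ derivable ('D_w f) y v) ->
  {for z, continuous ('D_w ('D_v f))} -> {for z, continuous ('D_v ('D_w f))} ->
  'D_w ('D_v f) z = 'D_v ('D_w f) z.
Proof.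
move=> d1 d2 c1 c2; set A := 'D_w ('D_v f) z; set B := 'D_v ('D_w f) z.
apply/eqP; rewrite -subr_eq0 -normr_le0; apply/ler_addgt0Pr => e e0.
rewrite add0r.
have e20 : 0 < e / 2 by rewrite divr_gt0.
have {}c1 : \forall y \near z, `|A - 'D_w ('D_v f) y| <= e / 2.
  by have /cvgrPdist_le/(_ _ e20) := c1.
have {}c2 : \forall y \near z, `|B - 'D_v ('D_w f) y| <= e / 2.
  have /cvgrPdist_le/(_ _ e20) := c2. exact.
have [r r0 H] := near_plane v w (filterI (filterI d1 d2) (filterI c1 c2)).
pose F y := f (r *: w + y) - f y.
pose G y := f (r *: v + y) - f y.
have rr : `|r| <= r by rewrite gtr0_norm.
have sw (a b : R) : a *: v + (b *: w + z) = b *: w + (a *: v + z).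
  by rewrite addrCA.
(* First mean value along [u] for the increment y |-> g (r u' + y) - g y, then along [u'] for the
   derivative of [g] along [u]. It is used for (v, w) and for (w, v). *)
have key (g : V -> R) (u u' : V) :
   (forall a b : R, `|a| <= r -> `|b| <= r -> derivable g (a *: u + (b *: u' + z)) u /\
      derivable ('D_u g) (a *: u + (b *: u' + z)) u') ->
   exists a b : R, [/\ `|a| <= r, `|b| <= r &
     g (r *: u + (r *: u' + z)) - g (r *: u' + z) - (g (r *: u + z) - g z) =
     r * r * 'D_u' ('D_u g) (a *: u + (b *: u' + z))].
  move=> dg; pose h y := g (r *: u' + y) - g y.
  have dh t : `|t| <= `|r| -> is_derive (t *: u + z) u h
      ('D_u g (r *: u' + (t *: u + z)) - 'D_u g (t *: u + z)).
    rewrite [X in _ <= X]gtr0_norm// => tr; apply: is_deriveB.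
      have /derivableP/is_derive_epsP K := (dg t r tr rr).1.
      apply/is_derive_epsP => e' /K[r' r'0 K']; exists r' => // s sr'.
      have := K' s sr'.
      by rewrite (addrCA (r *: u') (s *: u)) (addrCA (r *: u') (t *: u)).
    have := (dg t 0 tr); rewrite normr0 scale0r add0r => /(_ (ltW r0))[? _].
    exact: derivableP.
  have [|a ar E1] := @line_mean_value R V h z u r.
    by move=> t /dh ?; exact: ex_derive.
  rewrite [X in _ <= X]gtr0_norm// in ar.
  have [|b br E2] := @line_mean_value R V ('D_u g) (a *: u + z) u' r.
    move=> t; rewrite [X in _ <= X]gtr0_norm// => tr.
    by rewrite addrCA; exact: (dg a t ar tr).2.
  rewrite [X in _ <= X]gtr0_norm// in br.
  exists a, b; split; [exact: ar|exact: br|].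
  rewrite -mulrA [a *: u + _]addrCA -E2.
  have -> : 'D_u g (r *: u' + (a *: u + z)) - 'D_u g (a *: u + z) =
     'D_u h (a *: u + z).
    by apply/esym; apply: derive_val; apply: dh; rewrite [X in _ <= X]gtr0_norm.
  by rewrite -E1 /h (addrCA (r *: u')); lra.
have [a b ar br|a [b [ar br E]]] := key f v w.
  by have [[[? ?] [? ?]] _] := H a b ar br.
have [a' b' ar' br'|a' [b' [ar' br' E']]] := key f w v.
  by rewrite -sw; have [[[? ?] [? ?]] _] := H b' a' br' ar'.
have [_ [K _]] := H a b ar br.
have [_ [_ K']] := H b' a' br' ar'.
have EE : 'D_w ('D_v f) (a *: v + (b *: w + z)) = 'D_v ('D_w f) (b' *: v + (a' *: w + z)).
  have rn0 : r * r != 0 by rewrite mulf_neq0// gt_eqF.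
  rewrite (addrCA (b' *: v)).
  move: E E'; rewrite (addrCA (r *: w)).
  move: ('D_w _ _) ('D_v _ _) (f _) (f _) (f _) (f _) => X Y p1 p2 p3 p4 E E'.
  by apply: (mulfI rn0); rewrite -E -E'; ring.
move: K K'; rewrite EE {c1 c2 H EE E E'}; move: A B ('D_v _ _) => A B X K K'.
rewrite (splitr e) -[A](subrK X) -addrA.
apply: le_trans (ler_normD _ _) _; apply: lerD; [exact: K|rewrite distrC; exact: K'].
Qed.

Lemma derive_local_max f z v (d : R) :
  (\forall y \near z, derivable f y v) -> is_derive z v ('D_v f) d ->
  (\forall y \near z, f y <= f z) -> 'D_v f z = 0 /\ d <= 0.
Proof.
move=> df /is_derive_epsP ddf fmax.
have [r r0 H] := near_plane v 0 (filterI df fmax).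
have {}H (a : R) : `|a| <= r -> derivable f (a *: v + z) v /\ f (a *: v + z) <= f z.
  by move=> ar; have := H a 0 ar; rewrite scale0r add0r normr0 => /(_ (ltW r0)).
have itvr (t : R) : t \in `]-r, r[%R -> `|t| <= r.
  by rewrite in_itv/= => /andP[h1 h2]; rewrite ler_norml !ltW.
have D0 : 'D_v f z = 0.
  have K : is_derive (0 : R) 1 (fun s : R => f (s *: v + z)) 0.
    apply: (@derive1_at_max R _ (- r) r); first by lra.
    - move=> t /itvr/H[/derivableP/is_derive_line ? _]; exact: ex_derive.
    - by rewrite in_itv/=; lra.
    - by move=> t /itvr/H[_]; rewrite scale0r add0r.
  have := H 0; rewrite normr0 => /(_ (ltW r0))[/derivableP/is_derive_line K' _].
  move: (@derive_val _ _ _ _ _ _ _ K); rewrite (@derive_val _ _ _ _ _ _ _ K').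
  by rewrite scale0r add0r.
split=> //; rewrite leNgt; apply/negP => d0.
(* With error at most half of [d], the derivative along [v] is positive at all small positive
   parameters, so [f] would increase strictly away from [z]. *)
have [r1 r10 H1] := ddf _ (divr_gt0 d0 (ltr0n R 2)).
pose s := Num.min r r1 / 2.
have m0 : 0 < Num.min r r1 by rewrite lt_min r0.
have [sr sr1] : s < r /\ s < r1.
  have : Num.min r r1 <= r /\ Num.min r r1 <= r1 by rewrite !ge_min !lexx orbT.
  by rewrite /s; lra.
have s0 : 0 < s by rewrite divr_gt0.
have H' (t : R) : `|t| <= r -> is_derive t 1 (fun u : R => f (u *: v + z)) ('D_v f (t *: v + z)).
  by move=> /H[/derivableP/is_derive_line].
have [t ts||t] := @MVT R (fun u : R => f (u *: v + z))
   (fun u : R => 'D_v f (u *: v + z)) 0 s s0.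
- by apply: H'; move: ts; rewrite in_itv/= ler_norml => /andP[? ?]; lra.
- apply: derivable_within_continuous => t; rewrite in_itv/= => /andP[? ?].
  have [|//] := H' t; first by rewrite ler_norml; lra.
rewrite in_itv/= => /andP[t0 ts]; rewrite subr0 scale0r add0r.
have [_ fs] : derivable f (s *: v + z) v /\ f (s *: v + z) <= f z.
  by apply: H; rewrite ger0_norm ltW.
have : `|'D_v f (t *: v + z) - 'D_v f z - t * d| <= d / 2 * `|t|.
  by apply: H1; rewrite gtr0_norm//; lra.
rewrite D0 subr0 (gtr0_norm t0) ler_norml => /andP[K _] E.
have td : 0 < t * d by rewrite mulr_gt0.
have : 0 < 'D_v f (t *: v + z) * s by rewrite mulr_gt0//; lra.
lra.
Qed.

End Directional.

(** * C2 functions with explicit derivatives *)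

Section Calculus.
Set Implicit Arguments.
Unset Strict Implicit.
Context {R : realType} {n : nat}.
Notation pt := ('rV[R]_n * R)%type.
Implicit Types (G : set pt) (psi f g : pt -> R) (z : pt) (k l : option 'I_n)
  (F : option 'I_n -> pt -> R) (H : option 'I_n -> option 'I_n -> pt -> R).

(** A certificate naming the first and second partial derivatives, so that gradients and Hessians
    are read off rather than recomputed. On open sets it amounts to [C2_on], by [C2_on_data] and
    [C2_data_on]. *)
Definition C2_data G psi F H := forall z, G z ->
  [/\ {for z, continuous psi},
      forall k, is_derive z (coord_dir k) psi (F k z) /\ {for z, continuous (F k)} &
      forall k l, is_derive z (coord_dir l) (F k) (H k l z) /\
        {for z, continuous (H k l)}].

Lemma within_open_continuousP (T : topologicalType) (G : set T) (f : T -> R) :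
  open G -> {within G, continuous f} <-> (forall x, G x -> {for x, continuous f}).
Proof.
move=> oG; rewrite continuous_open_subspace//; split=> cf x Gx.
  by apply: cf; rewrite inE.
by apply: cf; rewrite inE in Gx.
Qed.

Lemma near_open_eq G f g z : open G -> G z -> (forall y, G y -> f y = g y) ->
  \forall y \near z, f y = g y.
Proof.
move=> oG Gz e; have : nbhs z G by exact: open_nbhs_nbhs.
by apply: filterS => y /e.
Qed.

Lemma eq_continuous_at (T : topologicalType) (f g : T -> R) (x : T) :
  (\forall y \near x, f y = g y) -> {for x, continuous f} -> {for x, continuous g}.
Proof.
move=> e cf; rewrite /prop_for /continuous_at -(nbhs_singleton e).
exact: cvg_trans (near_eq_cvg e) cf.
Qed.

Lemma C2_data_eq G f F H g F' H' : open G ->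
  (forall z, G z -> f z = g z) -> (forall k z, G z -> F k z = F' k z) ->
  (forall k l z, G z -> H k l z = H' k l z) ->
  C2_data G f F H -> C2_data G g F' H'.
Proof.
move=> oG ef eF eH D z Gz; have [cf dF dH] := D z Gz.
have nf := near_open_eq oG Gz ef.
have nF k := near_open_eq oG Gz (eF k).
have nH k l := near_open_eq oG Gz (eH k l).
split=> [|k|k l]; first exact: eq_continuous_at cf.
  have [d c] := dF k; split; last exact: eq_continuous_at c.
  by rewrite -eF//; exact: near_eq_is_derive d.
have [d c] := dH k l; split; last exact: eq_continuous_at c.
by rewrite -eH//; exact: near_eq_is_derive d.
Qed.

Lemma C2_on_data G psi : open G -> C2_on G psi ->
  C2_data G psi (fun k => 'D_(coord_dir k) psi)
    (fun k l => 'D_(coord_dir l) ('D_(coord_dir k) psi)).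
Proof.
move=> oG [c D1 D2] z Gz; split=> [|k|k l].
- exact: (within_open_continuousP _ oG).1 c z Gz.
- have [d c1] := D1 k; split; first exact/derivableP/d.
  exact: (within_open_continuousP _ oG).1 c1 z Gz.
- have [d c1] := D2 k l; split; first exact/derivableP/d.
  exact: (within_open_continuousP _ oG).1 c1 z Gz.
Qed.

Lemma C2_dataE G psi F H k z : C2_data G psi F H -> G z ->
  'D_(coord_dir k) psi z = F k z.
Proof. by move=> D Gz; have [_ /(_ k)[? _] _] := D z Gz; exact: derive_val. Qed.

Lemma C2_dataEE G psi F H k l z : open G -> C2_data G psi F H -> G z ->
  'D_(coord_dir l) ('D_(coord_dir k) psi) z = H k l z.
Proof.
move=> oG D Gz; have [_ _ /(_ k l)[? _]] := D z Gz.
rewrite (near_eq_derive _ (g := F k)); first exact: derive_val.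
by apply: near_open_eq oG Gz _ => y Gy; exact: C2_dataE D Gy.
Qed.

Lemma C2_data_on G psi F H : open G -> C2_data G psi F H -> C2_on G psi.
Proof.
move=> oG D; have E k : forall y, G y -> F k y = 'D_(coord_dir k) psi y.
  by move=> y Gy; rewrite (C2_dataE _ D Gy).
have E2 k l : forall y, G y -> H k l y = 'D_(coord_dir l) ('D_(coord_dir k) psi) y.
  by move=> y Gy; rewrite (C2_dataEE _ _ oG D Gy).
have D' := C2_data_eq oG (fun z _ => erefl (psi z)) E E2 D.
split=> [|k|k l].
- by apply/within_open_continuousP => // z /D'[].
- split=> [z /D'[_ /(_ k)[d _] _]|]; first exact: ex_derive.
  by apply/within_open_continuousP => // z /D'[_ /(_ k)[]].
- split=> [z /D'[_ _ /(_ k l)[d _]]|]; first exact: ex_derive.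
  by apply/within_open_continuousP => // z /D'[_ _ /(_ k l)[]].
Qed.

Lemma C2_onW G G' psi : G' `<=` G -> C2_on G psi -> C2_on G' psi.
Proof.
move=> GG [c d1 d2]; split=> [|k|k l].
- exact: continuous_subspaceW c.
- have [d c1] := d1 k; split=> [y /GG|]; first exact: d.
  exact: continuous_subspaceW c1.
- have [d c1] := d2 k l; split=> [y /GG|]; first exact: d.
  exact: continuous_subspaceW c1.
Qed.

Lemma C2_data_add G f F H g F' H' : C2_data G f F H -> C2_data G g F' H' ->
  C2_data G (fun z => f z + g z) (fun k z => F k z + F' k z)
    (fun k l z => H k l z + H' k l z).
Proof.
move=> D D' z Gz; have [cf dF dH] := D z Gz; have [cg dF' dH'] := D' z Gz.
split=> [|k|k l]; first exact: continuousD.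
  have [d c] := dF k; have [d' c'] := dF' k.
  by split; [exact: is_deriveD|exact: continuousD].
have [d c] := dH k l; have [d' c'] := dH' k l.
by split; [exact: is_deriveD|exact: continuousD].
Qed.

Lemma C2_data_mul G f F H g F' H' : C2_data G f F H -> C2_data G g F' H' ->
  C2_data G (fun z => f z * g z) (fun k z => F k z * g z + f z * F' k z)
    (fun k l z => H k l z * g z + F k z * F' l z + F l z * F' k z + f z * H' k l z).
Proof.
move=> D D' z Gz; have [cf dF dH] := D z Gz; have [cg dF' dH'] := D' z Gz.
have key (p q : pt -> R) (v : pt) (dp dq : R) : is_derive z v p dp -> is_derive z v q dq ->
    is_derive z v (fun y => p y * q y) (dp * q z + p z * dq).
  move=> d d'; apply: is_derive_eq (is_deriveM d d') _.
  by rewrite addrC; congr (_ + _); rewrite [LHS]mulrC.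
split=> [|k|k l]; first exact: continuousM.
  have [d c] := dF k; have [d' c'] := dF' k.
  by split; [exact: key|apply: continuousD; exact: continuousM].
have [d c] := dH k l; have [d' c'] := dH' k l.
have [dk ck] := dF k; have [dk' ck'] := dF' k.
have [dl cl] := dF l; have [dl' cl'] := dF' l.
split.
  rewrite -addrA; apply: (@is_deriveD _ _ _ (fun y => F k y * g y) (fun y => f y * F' k y));
    exact: key.
by do !apply: continuousD; exact: continuousM.
Qed.

Lemma C2_data_time G (h h1 h2 : R -> R) :
  (forall z, G z -> is_derive z.2 1 h (h1 z.2)) ->
  (forall z, G z -> is_derive z.2 1 h1 (h2 z.2)) ->
  (forall z, G z -> {for z.2, continuous h2}) ->
  C2_data G (fun z => h z.2) (fun k z => if k is None then h1 z.2 else 0)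
    (fun k l z => if (k, l) is (None, None) then h2 z.2 else 0).
Proof.
move=> dh dh1 ch2 z Gz.
have c2 (p : R -> R) : {for z.2, continuous p} -> {for z, continuous (fun y : pt => p y.2)}.
  by move=> cp; apply: (@continuous_comp _ _ _ snd p) => //; exact: cvg_snd.
have cd (p : R -> R) d : is_derive z.2 1 p d -> {for z.2, continuous p}.
  by move=> dp; apply: differentiable_continuous; apply/derivable1_diffP; exact: ex_derive.
have key (p : R -> R) (p1 : R) k : is_derive z.2 1 p p1 ->
    is_derive z (coord_dir k) (fun y : pt => p y.2) (if k is None then p1 else 0).
  case: k => [i|] dp; last first.
    by case: dp => d <-; split; [exact: d|].
  apply/is_derive_epsP => e e0; exists 1 => // s _ /=.
  by rewrite scaler0 add0r subrr mulr0 subr0 normr0 mulr_ge0// ltW.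
split=> [|k|k l]; first exact/c2/cd/dh.
  split; first by apply: key; exact: dh.
  by case: k => [i|]; [exact: cst_continuous|exact/c2/cd/dh1].
split.
  case: k => [i|]; first by case: l => [j|]; exact: is_derive_cst.
  by apply: key; exact: dh1.
by case: k l => [i|] [j|]; try exact: cst_continuous; exact/c2/ch2.
Qed.

(** The only shape of comparison function in the proof: its spatial Hessian is a multiple of the
    identity, which hides the singularity of the operator at zero gradient. *)
Definition quadratic (a : R) (xh : 'rV[R]_n) (h : R -> R) (z : pt) : R :=
  a * (\sum_i (z.1 0 i - xh 0 i) ^+ 2) + h z.2.

Lemma continuous_sum (T : topologicalType) (I : Type) (r : seq I) (f : I -> T -> R) (x : T) :
  (forall i, {for x, continuous (f i)}) ->
  {for x, continuous (fun y => \sum_(i <- r) f i y)}.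
Proof.
move=> cf; elim: r => [|i r IH].
  by under [X in {for _, continuous X}]eq_fun do rewrite big_nil; exact: cst_continuous.
under [X in {for _, continuous X}]eq_fun do rewrite big_cons.
exact: continuousD.
Qed.

Lemma continuous_coord i z : {for z, continuous (fun y : pt => y.1 0 i)}.
Proof.
apply: (@continuous_comp _ _ _ (fst : pt -> _) (fun x : 'rV[R]_n => x 0 i)).
  exact: cvg_fst.
exact: coord_continuous.
Qed.

Lemma is_derive_coord i z k :
  is_derive z (coord_dir k) (fun y : pt => y.1 0 i) (k == Some i)%:R.
Proof.
apply/is_derive_epsP => e e0; exists 1 => // s _.
have -> : (s *: coord_dir k + z).1 0 i - z.1 0 i - s * (k == Some i)%:R = 0.
  case: k => [j|] /=; rewrite !mxE ?eqxx/=.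
    by rewrite addrK [i == j]eq_sym subrr.
  by rewrite mulr0 add0r subrr subr0.
by rewrite normr0 mulr_ge0// ltW.
Qed.

Lemma C2_data_quadratic G (a : R) xh (h h1 h2 : R -> R) :
  (forall z, G z -> is_derive z.2 1 h (h1 z.2)) ->
  (forall z, G z -> is_derive z.2 1 h1 (h2 z.2)) ->
  (forall z, G z -> {for z.2, continuous h2}) ->
  C2_data G (quadratic a xh h)
    (fun k z => if k is Some i then 2 * a * (z.1 0 i - xh 0 i) else h1 z.2)
    (fun k l z => match k, l with
       | Some i, Some j => 2 * a * (i == j)%:R
       | None, None => h2 z.2
       | _, _ => 0 end).
Proof.
move=> dh dh1 ch2.
have D := C2_data_time dh dh1 ch2.
have cq i z : {for z, continuous (fun y : pt => y.1 0 i - xh 0 i)}.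
  by apply: continuousB; [exact: continuous_coord|exact: cst_continuous].
have dq i k z : is_derive z (coord_dir k) (fun y : pt => y.1 0 i - xh 0 i) (k == Some i)%:R.
  apply: is_derive_eq (is_deriveB (is_derive_coord i z k) (is_derive_cst (xh 0 i) z _)) _.
  by rewrite subr0.
have Q : C2_data G (fun z : pt => a * (\sum_i (z.1 0 i - xh 0 i) ^+ 2))
    (fun k z => if k is Some i then 2 * a * (z.1 0 i - xh 0 i) else 0)
    (fun k l z => match k, l with
       | Some i, Some j => 2 * a * (i == j)%:R
       | _, _ => 0 end).
  move=> z Gz; split=> [|k|k l].
  - apply: continuousM; first exact: cst_continuous.
    apply: continuous_sum => i.
    by under [X in {for _, continuous X}]eq_fun do rewrite expr2;
      exact: continuousM (cq i z) (cq i z).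
  - split.
      have E : (fun z : pt => a * (\sum_i (z.1 0 i - xh 0 i) ^+ 2)) =
         a \*: \sum_i (fun z : pt => z.1 0 i - xh 0 i) ^+ 2.
        by apply/funext => y; rewrite /= -[RHS]/(a * _) fct_sumE.
      rewrite E; apply: is_derive_eq
        (is_deriveZ a (is_derive_sum (fun i => is_deriveX 2 (dq i k z)))) _.
      case: k => [i|] /=.
        rewrite (bigD1 i)//= eqxx big1 ?addr0 => [|j ji].
          by rewrite expr1 /GRing.scale/= mulr1 -mulr_natl; ring.
        by rewrite eq_sym (negPf (_ : Some j != Some i)) ?scaler0.
      by rewrite big1 ?scaler0// => i _; rewrite scaler0.
    case: k => [i|]; last exact: cst_continuous.
    by apply: continuousM; [exact: cst_continuous|exact: cq].
  - split.
      case: k => [i|]; last by case: l => [?|]; exact: is_derive_cst.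
      have := is_deriveZ (2 * a) (dq i l z).
      move=> /is_derive_eq; apply; case: l => [j|]; last by rewrite scaler0.
      by rewrite -[LHS]/(_ * _) [i == j]eq_sym.
    by case: k l => [i|] [j|]; exact: cst_continuous.
move: (C2_data_add Q D); congr C2_data.
  by apply/funext => -[i|]; apply/funext => z; rewrite ?addr0 ?add0r.
by apply/funext => -[i|]; apply/funext => -[j|]; apply/funext => z; rewrite ?addr0 ?add0r.
Qed.

End Calculus.

(** * Quadratic forms on the unit sphere and the largest eigenvalue *)

Section Rayleigh.
Set Implicit Arguments.
Unset Strict Implicit.
Context {R : realType} {n : nat}.
Implicit Types (p q c : 'rV[R]_n) (X Y : 'M[R]_n).

Definition bilin X p q : R := (p *m X *m q^T) 0 0.
Definition quad X q : R := bilin X q q.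
Definition sqnorm q : R := \sum_i q 0 i ^+ 2.

Lemma bilinE X p q : bilin X p q = \sum_i \sum_j p 0 i * q 0 j * X i j.
Proof.
rewrite /bilin !mxE exchange_big/=; apply: eq_bigr => j _.
rewrite !mxE big_distrl/=; apply: eq_bigr => i _.
by rewrite mulrAC.
Qed.

Lemma sqnormE q : sqnorm q = (q *m q^T) 0 0.
Proof. by rewrite !mxE; apply: eq_bigr => i _; rewrite !mxE expr2. Qed.

Lemma sqnorm_ge0 q : 0 <= sqnorm q.
Proof. by apply: sumr_ge0 => i _; exact: sqr_ge0. Qed.

Lemma sqnorm_eq0 q : (sqnorm q == 0) = (q == 0).
Proof.
apply/idP/eqP => [|->]; last by rewrite /sqnorm big1// => i _; rewrite mxE expr0n.
rewrite psumr_eq0 => [/allP H|i _]; last exact: sqr_ge0.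
apply/rowP => i; apply/eqP; rewrite mxE -sqrf_eq0.
by apply: H; rewrite mem_index_enum.
Qed.

Lemma coord_sqr_le q i : q 0 i ^+ 2 <= sqnorm q.
Proof. by rewrite /sqnorm (bigD1 i)//= lerDl sumr_ge0// => j _; exact: sqr_ge0. Qed.

Lemma sqnormZ a q : sqnorm (a *: q) = a ^+ 2 * sqnorm q.
Proof. by rewrite mulr_sumr; apply: eq_bigr => i _; rewrite mxE exprMn. Qed.

Lemma quadZ X a q : quad X (a *: q) = a ^+ 2 * quad X q.
Proof.
by rewrite /quad /bilin linearZ/= -!scalemxAl -scalemxAr !mxE mulrA expr2.
Qed.

Lemma bilinC X p q : X^T = X -> bilin X p q = bilin X q p.
Proof.
move=> sX; rewrite /bilin -[LHS]/(_ 0 0).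
have -> : p *m X *m q^T = (q *m X *m p^T)^T by rewrite !trmx_mul trmxK sX mulmxA.
by rewrite mxE.
Qed.

Lemma quadD X p q : X^T = X ->
  quad X (p + q) = quad X p + 2 * bilin X p q + quad X q.
Proof.
move=> sX; rewrite mulrDl mul1r {2}(bilinC p q sX) /quad /bilin linearD/=.
by rewrite !mulmxDl !mulmxDr !mxE; lra.
Qed.

Lemma quad1 q : quad 1%:M q = sqnorm q.
Proof. by rewrite /quad /bilin mulmx1 sqnormE. Qed.

Lemma continuous_quad X : continuous (quad X).
Proof.
move=> q; have -> : quad X = fun q => \sum_i \sum_j q 0 i * q 0 j * X i j.
  by apply/funext => p; exact: bilinE.
have cc i : {for q, continuous (fun p : 'rV[R]_n => p 0 i)} by exact: coord_continuous.
apply: continuous_sum => i; apply: continuous_sum => j.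
apply: (continuousM (s := fun p : 'rV[R]_n => p 0 i * p 0 j)); last exact: cst_continuous.
exact: continuousM (cc i) (cc j).
Qed.

Lemma continuous_sqnorm : continuous sqnorm.
Proof.
have -> : sqnorm = quad 1%:M by apply/funext => q; rewrite quad1.
exact: continuous_quad.
Qed.

Lemma rV_norm_le q (M : R) : 0 <= M -> (forall i, `|q 0 i| <= M) -> `|q| <= M.
Proof.
move=> M0 H; have [q0|/mx_norm_neq0[[i j] /= E]] := eqVneq (mx_norm q) 0.
  by rewrite [X in X <= _]q0.
by rewrite [X in X <= _]E ord1.
Qed.

Lemma compact_unit_sphere : compact [set q | sqnorm q = 1].
Proof.
apply: bounded_closed_compact.
  exists 1; split=> // M M1 q /= q1; apply: le_trans (ltW M1).
  apply: rV_norm_le => // i.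
  by rewrite -(@expr_le1 _ 2)// -normrX ger0_norm ?sqr_ge0// -q1 coord_sqr_le.
apply: (@closed_comp _ _ sqnorm [set 1]); last exact: closed_eq.
by move=> q _; exact: continuous_sqnorm.
Qed.

Lemma sqnorm_delta i : sqnorm (delta_mx 0 i) = 1.
Proof.
rewrite /sqnorm (bigD1 i)//= mxE !eqxx expr1n big1 ?addr0// => j ji.
by rewrite mxE (negPf ji) expr0n.
Qed.

Lemma normalize q : q != 0 -> sqnorm ((Num.sqrt (sqnorm q))^-1 *: q) = 1.
Proof.
move=> q0; have s0 : 0 < sqnorm q by rewrite lt_def sqnorm_eq0 q0 sqnorm_ge0.
by rewrite sqnormZ exprVn sqr_sqrtr ?sqnorm_ge0// mulVf// gt_eqF.
Qed.

Lemma quad_le_sqnorm X (a : R) : (forall q, sqnorm q = 1 -> quad X q <= a) ->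
  forall q, quad X q <= a * sqnorm q.
Proof.
move=> H q; have [->|q0] := eqVneq q 0.
  by rewrite -(scale0r 0) quadZ sqnormZ expr0n !mul0r mulr0.
have s0 : 0 < sqnorm q by rewrite lt_def sqnorm_eq0 q0 sqnorm_ge0.
have := H _ (normalize q0).
by rewrite quadZ exprVn sqr_sqrtr ?sqnorm_ge0// ler_pdivrMl// mulrC.
Qed.

(* A maximiser of the quadratic form on the unit sphere is an eigenvector. *)
Lemma max_eigenvalue_quad X : (0 < n)%N -> X^T = X ->
  (exists2 q, sqnorm q = 1 & quad X q = max_eigenvalue X) /\
  (forall q, sqnorm q = 1 -> quad X q <= max_eigenvalue X).
Proof.
move=> n0 sX.
have [||c] := @EVT_max_rV R n (quad X) _ _ compact_unit_sphere.
- by exists (delta_mx 0 (Ordinal n0)); exact: sqnorm_delta.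
- by apply: continuous_subspaceT; exact: continuous_quad.
rewrite inE/= => c1 cmax; set a := quad X c.
have qa q : quad X q <= a * sqnorm q.
  by apply: quad_le_sqnorm => p p1; apply: cmax; rewrite inE.
have cq q : bilin X c q = a * bilin 1%:M c q.
  have b1 : 1%:M^T = 1%:M :> 'M[R]_n by rewrite trmx1.
  (* The form a |p|^2 - [quad X p] is nonnegative and vanishes at [c]. Expanded at p = c + s q, it
     leaves a linear term bounded by a quadratic one for every s, so the linear coefficient must be
     0. *)
  have K (s : R) : s * (2 * (bilin X c q - a * bilin 1%:M c q)) <=
      s ^+ 2 * (a * sqnorm q - quad X q).
    have := qa (c + s *: q); rewrite quadD// -quad1 quadD// !quadZ !quad1.
    have bs Y : bilin Y c (s *: q) = s * bilin Y c q.
      by rewrite /bilin linearZ/= -scalemxAr mxE.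
    rewrite !bs c1 -/a; lra.
  apply/eqP; rewrite -subr_eq0; apply/eqP.
  set D := _ - _ in K *; set E := _ - _ in K.
  have E0 : 0 <= E by rewrite subr_ge0 qa.
  (* This s yields 2 D^2 (E + 1) <= D^2 E, hence D = 0; the summand 1 covers E = 0. *)
  have := K (D / (E + 1)); rewrite expr_div_n => K1.
  have E1 : 0 < E + 1 by lra.
  have : D ^+ 2 * 2 * (E + 1) <= D ^+ 2 * E.
    have := ler_wpM2r (ltW (mulr_gt0 E1 E1)) K1.
    set lhs := (X in X <= _ -> _); set rhs := (X in _ <= X -> _).
    have -> : lhs = D ^+ 2 * 2 * (E + 1) by rewrite /lhs; field; rewrite gt_eqF.
    by have -> : rhs = D ^+ 2 * E by rewrite /rhs; field; rewrite gt_eqF.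
  move=> K2; apply/eqP; rewrite -sqrf_eq0 eq_le sqr_ge0 andbT.
  have := sqr_ge0 D; nra.
(* The weak identity [cq], tested on the basis vectors, is the eigenvector equation. *)
have ev : c *m X = a *: c.
  apply/rowP => j; have := cq (delta_mx 0 j).
  rewrite /bilin trmx_delta mulmx1 -!colE ![col _ _ _ _]mxE => ->.
  by rewrite mxE.
have c0 : c != 0 by rewrite -sqnorm_eq0 c1 oner_eq0.
have ea : eigenvalue X a by apply/eigenvalueP; exists c.
have ub : ubound [set b | eigenvalue X b] a.
  move=> b /= /eigenvalueP[v vX v0].
  have s0 : 0 < sqnorm v by rewrite lt_def sqnorm_eq0 v0 sqnorm_ge0.
  have := qa v; rewrite {1}/quad /bilin vX -scalemxAl mxE -sqnormE.
  by rewrite ler_pM2r.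
have -> : max_eigenvalue X = a.
  apply/eqP; rewrite eq_le; apply/andP; split.
    by apply: ge_sup => //; exists a.
  by apply: ub_le_sup => //; exists a.
by split=> [|q q1]; [exists c|have := qa q; rewrite q1 mulr1].
Qed.

End Rayleigh.

(** * Second-order conditions and the viscosity inequality for quadratics *)

Section SecondOrder.
Set Implicit Arguments.
Unset Strict Implicit.
Context {R : realType} {n : nat}.
Notation pt := ('rV[R]_n * R)%type.
Implicit Types (G : set pt) (psi f g : pt -> R) (z : pt) (k l : option 'I_n)
  (F : option 'I_n -> pt -> R) (H : option 'I_n -> option 'I_n -> pt -> R).

Definition visc_at psi z :=
  (grad psi z != 0 -> time_deriv psi z - infty_laplace psi z <= 0) /\
  (grad psi z = 0 -> time_deriv psi z - max_eigenvalue (hess psi z) <= 0).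

(** The C2 hypotheses concern coordinate directions only, whereas the second-order condition is
    needed in every spatial direction. Coordinates are added one at a time by [is_derive_dirD]. *)
Lemma is_derive_space G f (F : 'I_n -> pt -> R) z (q : 'rV[R]_n) : open G -> G z ->
  (forall y i, G y -> is_derive y (space_dir i) f (F i y)) ->
  (forall i, {for z, continuous (F i)}) ->
  is_derive z (q, 0) f (\sum_i q 0 i * F i z).
Proof.
move=> oG Gz df cF.
have nG : \forall y \near z, G y by exact: open_nbhs_nbhs.
suff S (r : seq 'I_n) : is_derive z (\sum_(i <- r) q 0 i *: space_dir i) f
    (\sum_(i <- r) q 0 i * F i z).
  have -> : (q, 0) = \sum_i q 0 i *: space_dir i :> pt; last exact: S.
  rewrite {1}(row_sum_delta q).
  elim/big_ind2 : _ => // [x1 x2 y1 y2 <- <-|i _].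
    by rewrite -[RHS]/(_, _)/= addr0.
  by rewrite /space_dir -[RHS]/(_, _)/= scaler0.
elim: r => [|i r IH]; first by rewrite !big_nil; exact: is_derive0.
rewrite !big_cons.
have dv y : G y -> is_derive y (q 0 i *: space_dir i) f (q 0 i * F i y).
  by move=> Gy; apply: is_derive_dirZ; exact: df.
have -> : q 0 i * F i z = 'D_(q 0 i *: space_dir i) f z.
  by apply/esym; apply: derive_val; exact: dv.
apply: is_derive_dirD IH.
  by apply: filterS nG => y /dv ?; exact: ex_derive.
apply: (@eq_continuous_at _ _ (fun y => q 0 i * F i y)).
  by apply: filterS nG => y /dv ?; apply/esym; exact: derive_val.
by apply: continuousM; [exact: cst_continuous|exact: cF].
Qed.

Lemma C2_data_local_max G f F H z : open G -> G z -> C2_data G f F H ->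
  (\forall y \near z, f y <= f z) ->
  (forall k, F k z = 0) /\
  forall q : 'rV[R]_n,
    \sum_i \sum_j q 0 i * q 0 j * H (Some i) (Some j) z <= 0.
Proof.
move=> oG Gz D fmax.
have nG : \forall y \near z, G y by exact: open_nbhs_nbhs.
split=> [k|q].
  rewrite -(C2_dataE k D Gz).
  apply: (proj1 (@derive_local_max R _ f z (coord_dir k) (H k k z) _ _ fmax)).
    by apply: filterS nG => y /D[_ /(_ k)[d _] _]; exact: ex_derive.
  apply: (@near_eq_is_derive _ _ _ (F k)).
    by apply: filterS nG => y Gy; rewrite (C2_dataE k D Gy).
  by have [_ _ /(_ k k)[]] := D z Gz.
have d1 y : G y -> is_derive y (q, 0) f (\sum_i q 0 i * F (Some i) y).
  move=> Gy; apply: (is_derive_space (f := f) (F := fun j => F (Some j)) q oG Gy) => [x i|i].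
    by move=> /D[_ /(_ (Some i))[]].
  by have [_ /(_ (Some i))[]] := D y Gy.
have d2 i : is_derive z (q, 0) (F (Some i)) (\sum_j q 0 j * H (Some i) (Some j) z).
  apply: (is_derive_space (f := F (Some i)) (F := fun j => H (Some i) (Some j)) q oG Gz) => [x j|j].
    by move=> /D[_ _ /(_ (Some i) (Some j))[]].
  by have [_ _ /(_ (Some i) (Some j))[]] := D z Gz.
apply: (proj2 (@derive_local_max R _ f z (q, 0) _ _ _ fmax)).
  by apply: filterS nG => y /d1 ?; exact: ex_derive.
apply: (@near_eq_is_derive _ _ _ (fun y => \sum_i q 0 i * F (Some i) y)).
  by apply: filterS nG => y /d1 ?; apply/esym; exact: derive_val.
have E : (fun y => \sum_i q 0 i * F (Some i) y) = \sum_i (q 0 i \*: F (Some i)).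
  by apply/funext => y; rewrite fct_sumE.
rewrite E; apply: is_derive_eq (is_derive_sum (fun i => is_deriveZ (q 0 i) (d2 i))) _.
apply: eq_bigr => i _; rewrite -[LHS]/(_ * _) mulr_sumr.
by apply: eq_bigr => j _; rewrite mulrA.
Qed.

Lemma hess_sym G psi z : open G -> C2_on G psi -> G z -> (hess psi z)^T = hess psi z.
Proof.
move=> oG /(C2_on_data oG) D Gz; apply/matrixP => i j; rewrite !mxE.
have nG : \forall y \near z, G y by exact: open_nbhs_nbhs.
apply: second_derivativeC.
- apply: filterS nG => y /D[_ d _].
  have [? _] := d (Some j); have [? _] := d (Some i).
  by split; exact: ex_derive.
- apply: filterS nG => y /D[_ _ d].
  have [? _] := d (Some j) (Some i); have [? _] := d (Some i) (Some j).
  by split; exact: ex_derive.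
- by have [_ _ /(_ (Some j) (Some i))[]] := D z Gz.
- by have [_ _ /(_ (Some i) (Some j))[]] := D z Gz.
Qed.

(** This puts both branches of the operator on the same footing: each is a value of the Hessian form
    at a unit vector, the normalised gradient here and a maximiser for the largest eigenvalue. *)
Lemma infty_laplaceE psi z :
  infty_laplace psi z =
  quad (hess psi z) ((Num.sqrt (sqnorm (grad psi z)))^-1 *: grad psi z).
Proof.
rewrite quadZ exprVn sqr_sqrtr ?sqnorm_ge0// /quad bilinE /infty_laplace.
by rewrite /sqnorm.
Qed.

Lemma time_derivE G psi F H z : C2_data G psi F H -> G z ->
  time_deriv psi z = F None z.
Proof. by move=> D Gz; rewrite /time_deriv -(C2_dataE None D Gz). Qed.

Lemma gradE G psi F H z : C2_data G psi F H -> G z ->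
  grad psi z = \row_i F (Some i) z.
Proof. by move=> D Gz; apply/rowP => i; rewrite !mxE -(C2_dataE (Some i) D Gz). Qed.

Lemma hessE G psi F H z : open G -> C2_data G psi F H -> G z ->
  hess psi z = \matrix_(i, j) H (Some i) (Some j) z.
Proof.
move=> oG D Gz; apply/matrixP => i j.
by rewrite !mxE -(C2_dataEE (Some i) (Some j) oG D Gz).
Qed.

Lemma C2_data_cst G (c : R) : C2_data G (fun=> c) (fun _ _ => 0) (fun _ _ _ => 0).
Proof.
by move=> z Gz; split=> [|k|k l]; try split; try exact: cst_continuous;
  exact: is_derive_cst.
Qed.

Lemma C2_data_opp G f F H : C2_data G f F H ->
  C2_data G (fun z => - f z) (fun k z => - F k z) (fun k l z => - H k l z).
Proof.
move=> D z /D[c d1 d2]; split=> [|k|k l]; first exact: continuousN.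
  by have [? ?] := d1 k; split; [exact: is_deriveN|exact: continuousN].
by have [? ?] := d2 k l; split; [exact: is_deriveN|exact: continuousN].
Qed.

(** Where the quadratic touches [psi] from below, the time derivatives agree and the Hessian of
    [psi] is at least 2a times the identity. Both branches of the operator are then at least 2a,
    whatever the gradient. *)
Lemma visc_at_touch G psi z (a : R) xh (h h1 h2 : R -> R) : (0 < n)%N ->
  open G -> G z -> C2_on G psi ->
  (forall z, G z -> is_derive z.2 1 h (h1 z.2)) ->
  (forall z, G z -> is_derive z.2 1 h1 (h2 z.2)) ->
  (forall z, G z -> {for z.2, continuous h2}) ->
  h1 z.2 <= 2 * a ->
  (\forall y \near z, quadratic a xh h y - psi y <= quadratic a xh h z - psi z) ->
  visc_at psi z.
Proof.
move=> n0 oG Gz C2 dh dh1 ch2 ha tmax.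
have D := C2_on_data oG C2.
have [F0 Hq] := C2_data_local_max oG Gz
  (C2_data_add (C2_data_quadratic a xh dh dh1 ch2) (C2_data_opp D)) tmax.
have sX := hess_sym oG C2 Gz.
have Hle q : 2 * a * sqnorm q <= quad (hess psi z) q.
  rewrite /quad bilinE -subr_le0 mulr_sumr -sumrB; apply: le_trans (Hq q).
  rewrite ler_sum// => i _ /=; under [leRHS]eq_bigr do rewrite mulrDr.
  have E : \sum_j q 0 i * q 0 j * (2 * a * (i == j)%:R) = 2 * a * q 0 i ^+ 2.
    rewrite (bigD1 i)//= eqxx big1 => [|j ji]; first by rewrite addr0 mulr1 -expr2 mulrC.
    by rewrite eq_sym (negPf ji) !mulr0.
  rewrite big_split/= E lerD2l -sumrN.
  by apply: ler_sum => j _; rewrite mxE mulrN.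
have tE : time_deriv psi z = h1 z.2.
  rewrite (time_derivE D Gz); apply/esym/eqP; rewrite -subr_eq0; apply/eqP.
  exact: F0 None.
have [[q q1 qL] Lge] := max_eigenvalue_quad n0 sX.
rewrite /visc_at tE !subr_le0; split=> [g0|_].
  rewrite infty_laplaceE//; apply: le_trans ha (le_trans _ (Hle _)).
  by rewrite normalize// mulr1.
by apply: le_trans ha _; rewrite -qL; have := Hle q; rewrite q1 mulr1.
Qed.

(** Both branches of the operator equal 2a on the quadratic itself. Used contrapositively: a
    quadratic with h' > 2a cannot serve as a test function at a maximum. *)
Lemma visc_at_quadratic G z (a : R) xh (h h1 h2 : R -> R) : (0 < n)%N ->
  open G -> G z ->
  (forall z, G z -> is_derive z.2 1 h (h1 z.2)) ->
  (forall z, G z -> is_derive z.2 1 h1 (h2 z.2)) ->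
  (forall z, G z -> {for z.2, continuous h2}) ->
  visc_at (quadratic a xh h) z -> h1 z.2 <= 2 * a.
Proof.
move=> n0 oG Gz dh dh1 ch2 [V1 V2].
have D := C2_data_quadratic a xh dh dh1 ch2.
have qE q : quad (hess (quadratic a xh h) z) q = 2 * a * sqnorm q.
  rewrite (hessE oG D Gz) /quad bilinE mulr_sumr; apply: eq_bigr => i _.
  rewrite (bigD1 i)//= big1 => [|j ji]; first by rewrite mxE eqxx mulr1 addr0 -expr2 mulrC.
  by rewrite mxE eq_sym (negPf ji) !mulr0.
have [g0|g0] := eqVneq (grad (quadratic a xh h) z) 0.
  have := V2 g0; rewrite (time_derivE D Gz) subr_le0 => /le_trans; apply.
  have [[q q1 <-] _] := max_eigenvalue_quad n0 (hess_sym oG (C2_data_on oG D) Gz).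
  by rewrite qE q1 mulr1.
have := V1 g0; rewrite (time_derivE D Gz) subr_le0 infty_laplaceE// => /le_trans; apply.
by rewrite qE normalize// mulr1.
Qed.

End SecondOrder.

(** * Parabolic barriers, and stability of a failing viscosity inequality *)

Section Barrier.
Set Implicit Arguments.
Unset Strict Implicit.
Context {R : realType} {n : nat}.
Notation pt := ('rV[R]_n * R)%type.
Implicit Types (G : set pt) (psi : pt -> R) (z : pt) (a b c d : R).

Definition parabola b c d (t0 t : R) : R := d + b * (t - t0) + c * (t - t0) ^+ 2.

(** The value at [z0] is [d], and the equation applied to this function gives b + 2c (t - t0) - 2a.
    Its sign decides between strict supersolution (positive) and subsolution (nonpositive). *)
Definition barrier (z0 : pt) a b c d : pt -> R :=
  quadratic a z0.1 (parabola b c d z0.2).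

Lemma is_derive_parabola b c d (t0 t : R) :
  is_derive t 1 (parabola b c d t0) (b + 2 * c * (t - t0)).
Proof.
apply/is_derive_epsP => e e0; have c0 : 0 < `|c| + 1 by rewrite ltr_wpDl.
exists (e / (`|c| + 1)); first exact: divr_gt0.
move=> s; rewrite ltr_pdivlMr// => se; rewrite [s *: 1]mulr1.
have -> : parabola b c d t0 (s + t) - parabola b c d t0 t - s * (b + 2 * c * (t - t0)) =
  c * s * s by rewrite /parabola; ring.
rewrite normrM ler_wpM2r// normrM mulrC (le_trans _ (ltW se))//.
by rewrite ler_wpM2l// lerDl.
Qed.

Lemma is_derive_parabola1 b c (t0 t : R) :
  is_derive t 1 (fun u : R => b + 2 * c * (u - t0)) (2 * c).
Proof.
have -> : (fun u : R => b + 2 * c * (u - t0)) = parabola (2 * c) 0 b t0.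
  by apply/funext => u; rewrite /parabola mul0r addr0.
by apply: is_derive_eq (is_derive_parabola _ _ _ _ _) _; ring.
Qed.

Lemma C2_data_barrier G z0 a b c d :
  C2_data G (barrier z0 a b c d)
    (fun k z => if k is Some i then 2 * a * (z.1 0 i - z0.1 0 i)
                else b + 2 * c * (z.2 - z0.2))
    (fun k l z => match k, l with
       | Some i, Some j => 2 * a * (i == j)%:R
       | None, None => 2 * c
       | _, _ => 0 end).
Proof.
apply: (C2_data_quadratic a z0.1 (h1 := fun t => b + 2 * c * (t - z0.2)) (h2 := fun=> 2 * c)).
- by move=> z _; exact: is_derive_parabola.
- by move=> z _; exact: is_derive_parabola1.
- by move=> z _; exact: cst_continuous.
Qed.

Lemma continuous_barrier z0 a b c d : continuous (barrier z0 a b c d).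
Proof. by move=> z; have [] := @C2_data_barrier setT z0 a b c d z I. Qed.

Lemma visc_at_barrier_below G psi z z0 a b c d : (0 < n)%N -> open G -> G z ->
  C2_on G psi -> b + 2 * c * (z.2 - z0.2) <= 2 * a ->
  (\forall y \near z, barrier z0 a b c d y - psi y <= barrier z0 a b c d z - psi z) ->
  visc_at psi z.
Proof.
move=> n0 oG Gz C2 hab.
apply: (visc_at_touch (h1 := fun t => b + 2 * c * (t - z0.2)) (h2 := fun=> 2 * c)
  n0 oG Gz C2) hab.
- by move=> y _; exact: is_derive_parabola.
- by move=> y _; exact: is_derive_parabola1.
- by move=> y _; exact: cst_continuous.
Qed.

Lemma visc_at_barrier z z0 a b c d : (0 < n)%N ->
  visc_at (barrier z0 a b c d) z -> b + 2 * c * (z.2 - z0.2) <= 2 * a.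
Proof.
move=> n0 V.
apply: (@visc_at_quadratic R n setT z a z0.1 (parabola b c d z0.2)
  (fun t => b + 2 * c * (t - z0.2)) (fun=> 2 * c) n0 openT I _ _ _ V).
- by move=> y _; exact: is_derive_parabola.
- by move=> y _; exact: is_derive_parabola1.
- by move=> y _; exact: cst_continuous.
Qed.

Lemma not_visc_at psi z : ~ visc_at psi z ->
  (grad psi z != 0 /\ infty_laplace psi z < time_deriv psi z) \/
  (grad psi z = 0 /\ max_eigenvalue (hess psi z) < time_deriv psi z).
Proof.
move=> nv; have [g0|g0] := eqVneq (grad psi z) 0.
  right; split=> //; rewrite ltNge; apply/negP => le; apply: nv; split=> [|_].
    by rewrite g0 eqxx.
  by rewrite subr_le0.
left; split=> //; rewrite ltNge; apply/negP => le; apply: nv; split=> [_|g0'].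
  by rewrite subr_le0.
by rewrite g0' eqxx in g0.
Qed.

Lemma not_visc_atI psi z :
  (grad psi z != 0 -> infty_laplace psi z < time_deriv psi z) ->
  (grad psi z = 0 -> max_eigenvalue (hess psi z) < time_deriv psi z) ->
  ~ visc_at psi z.
Proof.
move=> H1 H2 [V1 V2]; have [g0|g0] := eqVneq (grad psi z) 0.
  by have := V2 g0; rewrite subr_le0 leNgt H2.
by have := V1 g0; rewrite subr_le0 leNgt H1.
Qed.

Lemma quad_perturb (X Y : 'M[R]_n) q : sqnorm q = 1 ->
  quad X q <= quad Y q + \sum_i \sum_j `|X i j - Y i j|.
Proof.
move=> q1; rewrite /quad !bilinE -big_split/= ler_sum// => i _.
rewrite -big_split/= ler_sum// => j _; rewrite -lerBlDl -mulrBr.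
rewrite (le_trans (ler_norm _))// normrM ler_piMl// normrM mulr_ile1//;
  by rewrite -(@expr_le1 _ 2)// -normrX ger0_norm ?sqr_ge0// -q1 coord_sqr_le.
Qed.

Section C2.
Variables (G : set pt) (psi : pt -> R) (z0 : pt).
Hypotheses (n0 : (0 < n)%N) (oG : open G) (C2 : C2_on G psi) (Gz0 : G z0).

Lemma continuous_grad i : {for z0, continuous (fun z => grad psi z 0 i)}.
Proof.
have [_ /(_ (Some i))[_ c] _] := C2_on_data oG C2 Gz0.
by under [X in {for _, continuous X}]eq_fun do rewrite mxE.
Qed.

Lemma continuous_hess i j : {for z0, continuous (fun z => hess psi z i j)}.
Proof.
have [_ _ /(_ (Some i) (Some j))[_ c]] := C2_on_data oG C2 Gz0.
by under [X in {for _, continuous X}]eq_fun do rewrite mxE.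
Qed.

Lemma continuous_time_deriv : {for z0, continuous (time_deriv psi)}.
Proof. by have [_ /(_ None)[_ c] _] := C2_on_data oG C2 Gz0. Qed.

(** Failure is an open condition. At nonzero gradient everything is continuous; at zero gradient the
    strict bound on the largest eigenvalue is what survives nearby. *)
Lemma near_not_visc_at : ~ visc_at psi z0 -> \forall z \near z0, ~ visc_at psi z.
Proof.
move=> nv; have nG : \forall y \near z0, G y by exact: open_nbhs_nbhs.
have [[g0 lt]|[g0 lt]] := not_visc_at nv.
  have sc : {for z0, continuous (fun z => \sum_i (grad psi z 0 i) ^+ 2)}.
    apply: continuous_sum => i.
    under [X in {for _, continuous X}]eq_fun do rewrite expr2.
    exact: continuousM (@continuous_grad i) (@continuous_grad i).
  have s0 : \sum_i (grad psi z0 0 i) ^+ 2 != 0 by rewrite -[X in X != 0]/(sqnorm _) sqnorm_eq0.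
  have lc : {for z0, continuous (infty_laplace psi)}.
    apply: (continuousM (s := fun z => (\sum_i (grad psi z 0 i) ^+ 2)^-1)).
      exact: continuousV.
    apply: continuous_sum => i; apply: continuous_sum => j.
    apply: (continuousM (s := fun z => grad psi z 0 i * grad psi z 0 j)).
      exact: continuousM (@continuous_grad i) (@continuous_grad j).
    exact: continuous_hess.
  have lt' := continuousB continuous_time_deriv lc.
  have dgt : \forall z \near z0, 0 < (time_deriv psi - infty_laplace psi) z.
    by apply: (cvgr_gt _ lt'); rewrite subr_gt0.
  have gn : \forall z \near z0, \sum_i (grad psi z 0 i) ^+ 2 != 0.
    exact: (cvgr_neq0 _ sc).
  apply: filterS2 dgt gn => z; rewrite [X in _ < X]/(_ - _) subr_gt0 => zlt zn.
  apply: not_visc_atI => // g.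
  by move: zn; rewrite -[X in X != 0]/(sqnorm (grad psi z)) g sqnorm_eq0 eqxx.
pose s z := \sum_i \sum_j `|hess psi z i j - hess psi z0 i j|.
have sc : {for z0, continuous s}.
  apply: continuous_sum => i; apply: continuous_sum => j.
  apply: (continuous_comp (f := fun z => hess psi z i j - hess psi z0 i j)).
    by apply: continuousB; [exact: continuous_hess|exact: cst_continuous].
  exact: norm_continuous.
have sz0 : s z0 = 0.
  by rewrite /s big1// => i _; rewrite big1// => j _; rewrite subrr normr0.
have lt' := continuousB continuous_time_deriv sc.
have dgt : \forall z \near z0, max_eigenvalue (hess psi z0) < (time_deriv psi - s) z.
  apply: (cvgr_gt _ lt').
  by suff : max_eigenvalue (hess psi z0) < time_deriv psi z0 - s z0 by []; rewrite sz0 subr0.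
apply: filterS2 dgt nG => z; rewrite [X in _ < X]/(_ - _) => zlt Gz.
have [_ Lge] := max_eigenvalue_quad n0 (hess_sym oG C2 Gz0).
(* The gradient at the nearby point may or may not vanish; a bound at all unit vectors settles both
   branches. *)
have bnd q : sqnorm q = 1 -> quad (hess psi z) q < time_deriv psi z.
  move=> q1; apply: le_lt_trans (quad_perturb _ (hess psi z0) q1) _.
  by rewrite -ltrBrDr; apply: le_lt_trans zlt; exact: Lge.
apply: not_visc_atI => g.
  by rewrite infty_laplaceE//; apply: bnd; exact: normalize.
by have [[q q1 <-] _] := max_eigenvalue_quad n0 (hess_sym oG C2 Gz); exact: bnd.
Qed.

(** Adding eta times the squared distance to [z0] makes a maximum strict. At [z0] it changes neither
    gradient nor time derivative, and shifts the Hessian by 2 eta times the identity. *)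
Lemma perturb_not_visc_at : ~ visc_at psi z0 -> exists2 eta : R, 0 < eta &
  ~ visc_at (fun z => psi z + barrier z0 eta 0 eta 0 z) z0.
Proof.
move=> nv; have D := C2_on_data oG C2.
have sX := hess_sym oG C2 Gz0.
have D' eta := C2_data_add D (@C2_data_barrier G z0 eta 0 eta 0).
have gE eta : grad (fun z => psi z + barrier z0 eta 0 eta 0 z) z0 = grad psi z0.
  by rewrite (gradE (D' eta) Gz0); apply/rowP => i; rewrite !mxE subrr mulr0 addr0.
have tE eta : time_deriv (fun z => psi z + barrier z0 eta 0 eta 0 z) z0 = time_deriv psi z0.
  by rewrite (time_derivE (D' eta) Gz0) subrr mulr0 !addr0.
have hE eta : hess (fun z => psi z + barrier z0 eta 0 eta 0 z) z0 =
    hess psi z0 + (2 * eta)%:M.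
  rewrite (hessE oG (D' eta) Gz0); apply/matrixP => i j; rewrite !mxE.
  by case: eqP => _; rewrite ?mulr1 ?mulr0.
have qE eta q : sqnorm q = 1 -> quad (hess psi z0 + (2 * eta)%:M) q =
    quad (hess psi z0) q + 2 * eta.
  move=> q1; rewrite /quad /bilin mulmxDr mulmxDl mul_mx_scalar -scalemxAl mxE.
  by congr (_ + _); rewrite mxE -sqnormE q1 mulr1.
have [[g0 lt]|[g0 lt]] := not_visc_at nv.
  (* The shift 2 eta consumes half of the strict gap. *)
  exists ((time_deriv psi z0 - infty_laplace psi z0) / 4); first by lra.
  apply: not_visc_atI; rewrite gE ?tE => g; last by rewrite g eqxx in g0.
  rewrite infty_laplaceE gE// hE qE ?normalize// -infty_laplaceE//; lra.
exists ((time_deriv psi z0 - max_eigenvalue (hess psi z0)) / 4); first by lra.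
apply: not_visc_atI; rewrite gE ?tE ?hE => g; first by rewrite g0 eqxx in g.
set eta := _ / _.
have [|[q q1 <-] _] := @max_eigenvalue_quad _ _ (hess psi z0 + (2 * eta)%:M) n0.
  by rewrite linearD/= sX tr_scalar_mx.
have [_ /(_ q q1)] := max_eigenvalue_quad n0 sX.
rewrite qE// /eta; lra.
Qed.

End C2.
End Barrier.

(** * Upper semicontinuous extended-real functions *)

Section Semicontinuity.
Set Implicit Arguments.
Unset Strict Implicit.
Context {R : realType}.

Lemma limf_esup_leP (T : topologicalType) (u : T -> \bar R) (F : set_system T) (l : R) :
  Filter F -> (limf_esup u F <= l%:E)%E <->
  (forall a : R, l < a -> \forall y \near F, (u y < a%:E)%E).
Proof.
move=> FF; split=> [H a la|H].
  have : (limf_esup u F < a%:E)%E by apply: le_lt_trans H _; rewrite lte_fin.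
  move=> /ereal_inf_lt[_ [V FV <-] sV]; apply: filterS FV => y Vy.
  by apply: le_lt_trans sV; apply: ereal_sup_ubound; exists y.
apply/lee_addgt0Pr => e e0; rewrite -EFinD.
apply: (@le_trans _ _ (ereal_sup (u @` [set y | (u y < (l + e)%:E)%E]))).
  apply: ereal_inf_lbound; exists [set y | (u y < (l + e)%:E)%E] => //.
  by apply: H; rewrite ltrDl.
by apply: ge_ereal_sup => _ [y /= /ltW ? <-].
Qed.

Lemma lte_real_between (x : \bar R) (b : R) : (x < b%:E)%E ->
  exists2 a : R, (x < a%:E)%E & a < b.
Proof.
case: x => [r| |] //; last by exists (b - 1); rewrite ?ltNyr// ltrBlDr ltrDl.
rewrite lte_fin => rb; exists ((r + b) / 2); last by lra.
by rewrite lte_fin; lra.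
Qed.

(** Phrased with a filter and a bound [l] so as to cover both semicontinuity at an interior point
    and a limsup bound at a boundary point. *)
Lemma near_lt_sub (T : Type) (u : T -> \bar R) (f : T -> R) (F : set_system T)
    (l : \bar R) (q a : R) : Filter F ->
  (forall b : R, (l < b%:E)%E -> \forall y \near F, (u y < b%:E)%E) ->
  f @ F --> q -> (l - q%:E < a%:E)%E ->
  \forall y \near F, (u y - (f y)%:E < a%:E)%E.
Proof.
move=> FF Hu Hf; rewrite lteBlDr// -EFinD => /lte_real_between[b lb ba].
have fb : \forall y \near F, b - a < f y by apply: (cvgr_gt _ Hf); lra.
apply: filterS2 (Hu _ lb) fb => y ub fy; rewrite lteBlDr// -EFinD.
by apply: lt_trans ub _; rewrite lte_fin; lra.
Qed.

(** The superlevel sets at attained values are nested and generate a proper filter. A cluster point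
    is a maximiser: were its value below some [w y], semicontinuity would give it a neighbourhood
    missing a superlevel set. *)
Lemma compact_usc_max (T : topologicalType) (K : set T) (w : T -> \bar R) :
  K !=set0 -> compact K ->
  (forall z, K z -> forall a : R, (w z < a%:E)%E ->
    \forall y \near within K (nbhs z), (w y < a%:E)%E) ->
  exists2 z, K z & forall y, K y -> (w y <= w z)%E.
Proof.
move=> [x Kx] cK usc.
pose F : set_system T := [set A | exists2 y, K y &
  [set u | K u /\ (w y <= w u)%E] `<=` A].
have FF : ProperFilter F.
  apply: Build_ProperFilter.
    by move=> [y Ky H]; have := H y; apply.
  split; first by exists x.
    move=> A B [y Ky yA] [y' Ky' yB]; have [le|/ltW le] := leP (w y) (w y').
      exists y' => // u [Ku h]; split; last exact: yB.
      by apply: yA; split=> //; exact: le_trans le h.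
    exists y => // u [Ku h]; split; first exact: yA.
    by apply: yB; split=> //; exact: le_trans le h.
  by move=> A B AB [y Ky yA]; exists y => //; exact: subset_trans yA AB.
have [|z [Kz cl]] := cK F FF; first by exists x => // u [].
exists z => // y Ky; rewrite leNgt; apply/negP => wzy.
(* Semicontinuity is stated for real thresholds, so infinite values are treated separately. *)
have [a za ay] : exists2 a : R, (w z < a%:E)%E & (a%:E <= w y)%E.
  move: wzy; case: (w y) => [r||]; last by rewrite ltNge leNye.
    by move=> /lte_real_between[b zb br]; exists b; rewrite ?lee_fin ?ltW.
  case: (w z) => [r _||_].
  - by exists (r + 1); rewrite ?leey// lte_fin ltrDl.
  - by rewrite ltxx.
  - by exists 0; rewrite ?ltNyr ?leey.
have := usc z Kz a za; rewrite /within/= => near.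
have Fy : F [set u | K u /\ (w y <= w u)%E] by exists y.
have [u [[Ku wu] /(_ Ku)]] := cl _ _ Fy near.
by rewrite ltNge (le_trans ay wu).
Qed.

End Semicontinuity.

(** * Comparison with barriers, and a gluing principle *)

Section Comparison.
Set Implicit Arguments.
Unset Strict Implicit.
Context {R : realType} {n : nat}.
Notation pt := ('rV[R]_n * R)%type.
Implicit Types (G : set pt) (psi : pt -> R) (z : pt) (a b c d : R) (u v : pt -> \bar R).

Lemma boundary_openP G z : open G -> boundary G z <-> closure G z /\ ~ G z.
Proof.
move=> oG; rewrite /boundary; split=> [[cz nz]|[cz nz]]; split=> // Gz; apply: nz.
  by move/interior_id : oG => ->.
exact: interior_subset.
Qed.

Lemma compact_closure_bounded G : bounded_set G -> compact (closure G).
Proof.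
move=> [M [_ HM]]; pose N := M + 1.
pose B := [set x : 'rV[R]_n | `|x| <= N] `*` [set t : R | `|t| <= N].
have cB : compact B.
  apply: compact_setX; first apply: bounded_closed_compact.
  - exists N; split; first exact: num_real.
    by move=> x Nx y /= yN; apply: le_trans yN (ltW Nx).
  - apply: (@closed_comp _ _ (fun x : 'rV[R]_n => `|x|) [set s : R | s <= N]).
      by move=> x _; exact: norm_continuous.
    exact: closed_le.
  - have -> : [set t : R | `|t| <= N] = `[(- N), N]%classic.
      by apply/seteqP; split=> t /=; rewrite in_itv/= ler_norml.
    exact: segment_compact.
apply: (subclosed_compact _ cB); first exact: closed_closure.
have clB : closed B by apply: compact_closed.
rewrite (iffLR (closure_id B) clB); apply: closure_subset => z Gz.
have : `|z| <= N by apply: HM => //; rewrite ltrDl.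
by rewrite [`|z|]prod_normE ge_max => /andP[].
Qed.

Lemma subsolutionP G u : subsolution G u <->
  [/\ forall z, G z -> (u z < +oo)%E, usc_on G u &
    forall psi z0, C2_on G psi -> G z0 ->
      (forall z, G z -> (u z - (psi z)%:E <= u z0 - (psi z0)%:E)%E) ->
      visc_at psi z0].
Proof. by []. Qed.

Lemma near_within_boundary_lt G u (l : R) z :
  (limf_esup u (within G (nbhs z)) <= l%:E)%E ->
  forall a : R, (l%:E < a%:E)%E -> \forall y \near within G (nbhs z), (u y < a%:E)%E.
Proof. by move=> /limf_esup_leP H a la; apply: H. Qed.

(* Only the points where [v] exceeds the barrier matter: a positive maximum of
   the difference is interior, and there the barrier is a test function. *)
Lemma comparison G z0 a b c d v : (0 < n)%N -> open G -> bounded_set G ->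
  subsolution G v ->
  (forall z, boundary G z ->
    (limf_esup v (within G (nbhs z)) <= (barrier z0 a b c d z)%:E)%E) ->
  (forall z, G z -> ((barrier z0 a b c d z)%:E < v z)%E ->
    2 * a < b + 2 * c * (z.2 - z0.2)) ->
  forall z, G z -> (v z <= (barrier z0 a b c d z)%:E)%E.
Proof.
move=> n0 oG bG /subsolutionP[vfin vusc vsub] vbd super z Gz.
set Q := barrier _ _ _ _ _ in vbd super *.
rewrite leNgt; apply/negP => Qv.
(* Truncating at 0 and extending by 0 turns the boundary limsup condition into upper semicontinuity
   on the compact closure; a positive maximum is then attained inside [G]. *)
pose w y := if `[< G y >] then maxe (v y - (Q y)%:E)%E 0%E else 0%E.
have wG y : G y -> w y = maxe (v y - (Q y)%:E)%E 0%E by move=> Gy; rewrite /w asboolT.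
have wN y : ~ G y -> w y = 0%E by move=> Gy; rewrite /w asboolF.
have w0 y : (0 <= w y)%E by rewrite /w; case: asboolP => // _; rewrite le_max lexx orbT.
have cQ : continuous Q by exact: continuous_barrier.
have [|y cy e0|z1 cz1 zmax] := @compact_usc_max R _ (closure G) w _ (compact_closure_bounded bG).
- by exists z; exact: subset_closure.
- move=> we0; have e_gt0 : (0 < e0%:E)%E by exact: le_lt_trans (w0 y) we0.
  have Hy : \forall x \near within G (nbhs y), (v x - (Q x)%:E < e0%:E)%E.
    have cQy : Q x @[x --> within G (nbhs y)] --> Q y.
      by apply: cvg_within_filter; exact: cQ.
    have [Gy|nGy] := pselect (G y).
      apply: (near_lt_sub (l := v y)) cQy _; first exact: vusc.
      by apply: le_lt_trans we0; rewrite wG// le_max lexx.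
    apply: (near_lt_sub (l := (Q y)%:E)) cQy _; last by rewrite subee.
    by apply: near_within_boundary_lt; apply: vbd; apply/boundary_openP.
  have {}Hy : \forall x \near y, G x -> (v x - (Q x)%:E < e0%:E)%E := Hy.
  suff : \forall x \near y, closure G x -> (w x < e0%:E)%E by [].
  apply: filterS Hy => x Hx _.
  have [Gx|nGx] := pselect (G x); last by rewrite wN.
  by rewrite wG// gt_max Hx.
have wz : (0 < w z)%E by rewrite wG// lt_max sube_gt0 Qv.
have wz1 : (0 < w z1)%E by apply: lt_le_trans wz (zmax _ _); exact: subset_closure.
have Gz1 : G z1 by apply: contrapT => /wN e; rewrite e ltxx in wz1.
have vz1 : w z1 = (v z1 - (Q z1)%:E)%E.
  move: wz1; rewrite wG// lt_max ltxx orbF => h.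
  by rewrite max_l// ltW.
have Qv1 : ((Q z1)%:E < v z1)%E by rewrite -sube_gt0// -vz1.
have := super _ Gz1 Qv1; rewrite ltNge => /negP; apply.
apply: visc_at_barrier n0 _; apply: (vsub _ z1 _ Gz1) => [|y Gy].
  exact: (C2_data_on oG (@C2_data_barrier R n G z0 a b c d)).
rewrite -/Q -vz1; apply: le_trans (zmax y (subset_closure Gy)).
by rewrite wG// le_max lexx.
Qed.

(** A test function touching [v] from above at a point also touches any function below [v] with the
    same value there. So it suffices that at each point some subsolution, on a set containing it, or
    some barrier supports [v] from below. *)
Lemma subsolution_glue G v : (0 < n)%N -> open G ->
  (forall z, G z -> (v z < +oo)%E) -> usc_on G v ->
  (forall z, G z ->
    (exists G' u, [/\ G' `<=` G, G' z, subsolution G' u, u z = v z &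
       forall y, G' y -> (u y <= v y)%E]) \/
    (exists z0 a b c d, [/\ b + 2 * c * (z.2 - z0.2) <= 2 * a,
       v z = (barrier z0 a b c d z)%:E &
       \forall y \near z, ((barrier z0 a b c d y)%:E <= v y)%E])) ->
  subsolution G v.
Proof.
move=> n0 oG vfin vusc H; apply/subsolutionP; split=> // psi z C2 Gz vmax.
have [[G' [u [GG Gz' /subsolutionP[_ _ us] uz uv]]]|] := H z Gz.
  apply: us => //.
    exact: C2_onW GG C2.
  move=> y Gy; rewrite uz; apply: le_trans (vmax y (GG y Gy)).
  by apply: leeB => //; exact: uv.
move=> [z0 [a [b [c [d [hab vz near]]]]]].
apply: (visc_at_barrier_below (d := d) n0 oG Gz C2 hab).
have nG : \forall y \near z, G y by exact: open_nbhs_nbhs.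
apply: filterS2 near nG => y le Gy; rewrite -lee_fin !EFinB -vz.
by apply: le_trans (vmax y Gy); exact: leeB.
Qed.

End Comparison.

(** * A C2 cutoff in time *)

Section Cutoff.
Set Implicit Arguments.
Unset Strict Implicit.
Context {R : realType}.

(** Lower powers of the positive part are not C2 at 0. *)
Definition pos_cube (t : R) : R := Num.max t 0 ^+ 3.

Lemma is_derive_pos_part_exp (k : nat) (t : R) :
  is_derive t 1 (fun u : R => Num.max u 0 ^+ k.+2) (k.+2%:R * Num.max t 0 ^+ k.+1).
Proof.
have [t0|t0|->] := ltgtP t 0.
- rewrite expr0n mulr0; apply: (@near_eq_is_derive _ _ _ (cst 0)).
    near=> u; rewrite max_r ?expr0n// ltW//; near: u; exact: lt_nbhsl.
- apply: (@near_eq_is_derive _ _ _ (fun u : R => u ^+ k.+2)).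
    near=> u; rewrite max_l// ltW//; near: u; exact: lt_nbhsr.
  have := is_deriveX k.+2 (is_derive_id t 1); rewrite fctE => /is_derive_eq; apply.
  by rewrite -[LHS]/(_ * _) mulr1.
rewrite expr0n mulr0; apply/is_derive_epsP => e e0.
exists (Num.min 1 e); first by rewrite lt_min ltr01.
move=> s; rewrite lt_min => /andP[/ltW s1 /ltW se].
rewrite [s *: 1]mulr1 addr0 maxxx expr0n !subr0 mulr0 subr0.
have mx : `|Num.max s 0| <= `|s|.
  by case: (leP s 0) => h; rewrite ?normr0.
rewrite normrX (le_trans (lerXn2r _ _ _ mx)) ?nnegrE//.
rewrite exprS mulrC ler_wpM2r// exprS (le_trans _ se)// ler_piMr// exprn_ile1//.
Unshelve. all: by end_near. Qed.

Lemma is_derive_pos_cube (t : R) : is_derive t 1 pos_cube (3 * Num.max t 0 ^+ 2).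
Proof. exact: is_derive_pos_part_exp. Qed.

Lemma pos_cube_ge0 t : 0 <= pos_cube t.
Proof. by rewrite exprn_ge0// le_max lexx orbT. Qed.

Lemma continuous_pos_part : continuous (fun t : R => Num.max t 0).
Proof.
move=> t; apply: (@continuous_max _ _ id (cst 0)) => //; exact: cst_continuous.
Qed.

Lemma exists_cutoff (t1 t2 : R) : t1 < t2 -> exists chi chi1 chi2 : R -> R,
  [/\ (forall t : R, is_derive t 1 chi (chi1 t)),
      (forall t : R, is_derive t 1 chi1 (chi2 t)), continuous chi2,
      (forall t, 0 <= chi t <= 1) &
      (forall t, t <= t1 -> chi t = 1) /\ (forall t, t2 <= t -> chi t = 0)].
Proof.
move=> t12; pose k := ((t2 - t1) ^+ 3)^-1.
have d0 : 0 < t2 - t1 by rewrite subr_gt0.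
have k0 : 0 < k by rewrite invr_gt0 exprn_gt0.
pose m (t : R) := Num.max (t - t1) 0.
(* The cutoff is the positive-part cube of [g]: [g] is 1 up to [t1], and [k] is scaled so that [g]
   reaches 0 exactly at [t2]. *)
pose g (t : R) := 1 - k * pos_cube (t - t1).
pose g1 (t : R) := - k * (3 * m t ^+ 2).
pose g2 (t : R) := - k * (3 * (2 * m t)).
have sh (t : R) : is_derive t 1 (fun u : R => u - t1) 1.
  by apply: is_derive_eq (is_deriveB (is_derive_id t 1) (is_derive_cst t1 t 1)) _; rewrite subr0.
have dg (t : R) : is_derive t 1 g (g1 t).
  have := is_deriveB (is_derive_cst (1 : R) t 1)
    (is_deriveZ k (@is_derive1_comp _ pos_cube (fun u : R => u - t1) t _ _
      (is_derive_pos_cube (t - t1)) (sh t))).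
  by move=> /is_derive_eq; apply; rewrite mulr1 sub0r /g1 mulNr.
have dg1 (t : R) : is_derive t 1 g1 (g2 t).
  have := is_deriveZ (- k) (is_deriveZ 3
    (@is_derive1_comp _ (fun u : R => Num.max u 0 ^+ 2) (fun u : R => u - t1) t _ _
      (is_derive_pos_part_exp 0 (t - t1)) (sh t))).
  by move=> /is_derive_eq; apply; rewrite mulr1.
have cm : continuous m.
  move=> t; apply: (@continuous_comp _ _ _ (fun u : R => u - t1) (fun u : R => Num.max u 0)).
    by apply: continuousB => //; exact: cst_continuous.
  exact: continuous_pos_part.
have cd (f f1 : R -> R) : (forall t : R, is_derive t 1 f (f1 t)) -> continuous f.
  by move=> df t; apply: differentiable_continuous; apply/derivable1_diffP; exact: ex_derive.
pose M t := Num.max (g t) 0.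
have cM : continuous M.
  move=> t; apply: (@continuous_comp _ _ _ g (fun u : R => Num.max u 0)).
    exact: cd dg t.
  exact: continuous_pos_part.
exists (pos_cube \o g), (fun t => (3 * M t ^+ 2) * g1 t),
  (fun t => (3 * (2 * M t * g1 t)) * g1 t + (3 * M t ^+ 2) * g2 t); split.
- by move=> t; exact: (@is_derive1_comp _ pos_cube g t _ _ (is_derive_pos_cube (g t)) (dg t)).
- move=> t.
  have := is_deriveM (is_deriveZ 3 (@is_derive1_comp _ (fun u : R => Num.max u 0 ^+ 2) g t _ _
      (is_derive_pos_part_exp 0 (g t)) (dg t)))
    (dg1 t).
  move=> /is_derive_eq; apply.
  rewrite -[LHS]/(3 * M t ^+ 2 * g2 t + g1 t * (3 * (2 * M t * g1 t))); ring.
- have cg1 : continuous g1 := cd _ _ dg1.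
  have cZ (a : R) (f : R -> R) : continuous f -> continuous (fun t => a * f t).
    by move=> cf t; apply: continuousM; [exact: cst_continuous|exact: cf].
  have cX (f p : R -> R) : continuous f -> continuous p -> continuous (fun t => f t * p t).
    by move=> cf cp t; apply: continuousM; [exact: cf|exact: cp].
  have cg2 : continuous g2 by apply/cZ/cZ/cZ.
  have c1 : continuous (fun t => 3 * (2 * M t * g1 t) * g1 t).
    by apply: (cX _ g1) => //; apply/cZ/(cX (fun t => 2 * M t) g1) => //; exact: cZ.
  have c2 : continuous (fun t => 3 * M t ^+ 2 * g2 t).
    by apply: (cX _ g2) => //; apply/cZ/(cX M M).
  by move=> t; exact: continuousD (c1 t) (c2 t).
- move=> t /=; rewrite pos_cube_ge0/= exprn_ile1// ?le_max ?lexx ?orbT//.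
  by rewrite ge_max ler01 andbT /g gerBl mulr_ge0 ?pos_cube_ge0// ltW.
- split=> t tt /=; rewrite /g.
    rewrite /pos_cube [X in k * X ^+ 3]max_r ?subr_le0// expr0n mulr0 subr0.
    by rewrite max_l// expr1n.
  rewrite {1}/pos_cube max_r ?expr0n// subr_le0.
  have tm : t2 - t1 <= Num.max (t - t1) 0 by rewrite le_max lerB.
  rewrite /k mulrC ler_pdivlMr ?exprn_gt0// mul1r.
  by rewrite lerXn2r// nnegrE ?(ltW d0)// (le_trans (ltW d0)).
Qed.

End Cutoff.

(** * Penalised subsolutions and restriction to earlier times *)

Section Subsolutions.
Set Implicit Arguments.
Unset Strict Implicit.
Context {R : realType} {n : nat}.
Notation pt := ('rV[R]_n * R)%type.
Implicit Types (G : set pt) (psi : pt -> R) (z : pt) (a b c d : R) (u v : pt -> \bar R).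

Lemma open_before (t0 : R) G : open G -> open (before t0 G).
Proof.
move=> oG; apply: openI => //.
apply: (@open_comp _ _ (snd : pt -> R) [set t | t < t0]); last exact: open_lt.
by move=> z _; exact: cvg_snd.
Qed.

Lemma is_derive_inv_sub (t0 t : R) : t < t0 ->
  is_derive t 1 (fun u : R => (t0 - u)^-1) ((t0 - t)^-1 * (t0 - t)^-1).
Proof.
move=> tt; have n0 : t0 - t != 0 by rewrite subr_eq0 gt_eqF.
have d : is_derive t 1 (fun u : R => t0 - u) (-1).
  by apply: is_derive_eq (is_deriveB (is_derive_cst t0 t 1) (is_derive_id t 1)) _; rewrite sub0r.
have /is_derive_eq := @is_deriveV _ (fun u : R => t0 - u) t _ 1 n0 d; apply.
by rewrite -[LHS]/(_ * -1) mulrN1 opprK expr2 invfM.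
Qed.

Lemma C2_data_blowup G (t0 delta : R) : (forall z, G z -> z.2 < t0) ->
  let r t := (t0 - t)^-1 in
  C2_data G (fun z => delta * r z.2)
    (fun k z => if k is None then delta * (r z.2 * r z.2) else 0)
    (fun k l z => if (k, l) is (None, None) then
       delta * (2 * (r z.2 * r z.2 * r z.2)) else 0).
Proof.
move=> Gt r.
apply: (C2_data_time (h := fun t => delta * r t)
  (h1 := fun t => delta * (r t * r t)) (h2 := fun t => delta * (2 * (r t * r t * r t)))).
- by move=> z /Gt zt; have := is_deriveZ delta (is_derive_inv_sub zt).
- move=> z /Gt zt; have d := is_derive_inv_sub zt.
  have /is_derive_eq := is_deriveZ delta (is_deriveM d d); apply.
  rewrite -[LHS]/(delta * (r z.2 * (r z.2 * r z.2) + r z.2 * (r z.2 * r z.2))); ring.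
- move=> z /Gt zt; have d := is_derive_inv_sub zt.
  have cr : {for z.2, continuous r}.
    by apply: differentiable_continuous; apply/derivable1_diffP; exact: ex_derive.
  have c1 := continuousM (continuousM cr cr) cr.
  have c2 : {for z.2, continuous (fun t => 2 * (r t * r t * r t))}.
    by apply: continuousM c1; exact: cst_continuous.
  by apply: continuousM c2; exact: cst_continuous.
Qed.

Lemma usc_on_sub_continuous G u psi : (forall z, G z -> {for z, continuous psi}) ->
  usc_on G u -> usc_on G (fun z => (u z - (psi z)%:E)%E).
Proof.
move=> cpsi usc z Gz a; apply: near_lt_sub; first exact: usc.
by apply: cvg_within_filter; exact: cpsi.
Qed.

(** The viscosity inequality is monotone in the time derivative, so for that one an inequality is
    enough. *)
Lemma visc_at_eq psi psi' z : grad psi z = grad psi' z -> hess psi z = hess psi' z ->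
  time_deriv psi z <= time_deriv psi' z -> visc_at psi' z -> visc_at psi z.
Proof.
move=> eg eh et [V1 V2]; have el : infty_laplace psi z = infty_laplace psi' z.
  by rewrite /infty_laplace eg eh.
rewrite /visc_at el eh eg; split=> g.
  by apply: le_trans (V1 g); rewrite lerB.
by apply: le_trans (V2 g); rewrite lerB.
Qed.

(** If [psi] tests the penalised function, then psi + delta / (t0 - t) tests [v]; it has the same
    spatial derivatives and a time derivative at least as large. *)
Lemma subsolution_sub_blowup G v (t0 delta : R) : open G -> 0 <= delta ->
  (forall z, G z -> z.2 < t0) -> subsolution G v ->
  subsolution G (fun z => (v z - (delta / (t0 - z.2))%:E)%E).
Proof.
move=> oG d0 Gt /subsolutionP[vfin vusc vs]; apply/subsolutionP.
have D := C2_data_blowup delta Gt; cbv zeta in D.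
split=> [z Gz||psi z C2 Gz vmax].
- by rewrite lteBlDr// ltey_eq; have := vfin z Gz; rewrite ltey_eq => /orP[/fineK<-|/eqP->].
- by apply: usc_on_sub_continuous vusc => z /D[].
have D' := C2_data_add (C2_on_data oG C2) D.
have := vs _ z (C2_data_on oG D') Gz; apply: contraPP => nv H; apply: nv.
apply: visc_at_eq (H _).
- by rewrite (gradE D' Gz); apply/rowP => i; rewrite !mxE addr0.
- by rewrite (hessE oG D' Gz); apply/matrixP => i j; rewrite !mxE addr0.
- by rewrite (time_derivE D' Gz) lerDl mulr_ge0// -expr2 sqr_ge0.
move=> y Gy; have := vmax y Gy.
by rewrite !EFinD !oppeD// !addeA ![(_ - (psi _)%:E - _)%E]addeAC.
Qed.

Lemma C2_on_local G psi : open G ->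
  (forall z, G z -> exists G', [/\ open G', G' z & C2_on G' psi]) -> C2_on G psi.
Proof.
move=> oG H; apply: (C2_data_on oG
  (F := fun k => 'D_(coord_dir k) psi)
  (H := fun k l => 'D_(coord_dir l) ('D_(coord_dir k) psi))).
by move=> z /H[G' [oG' Gz' /(C2_on_data oG')]]; exact.
Qed.

(* A test function on the part of [G] before [t0] may be wild near time [t0];
   it is replaced by a constant there, which needs [v] to be bounded. *)
Lemma subsolution_before G v (t0 m M : R) : open G -> subsolution G v ->
  (forall z, G z -> (m%:E <= v z <= M%:E)%E) -> subsolution (before t0 G) v.
Proof.
move=> oG /subsolutionP[vfin vusc vs] vb; have oB : open (before t0 G) by exact: open_before.
have vE z : G z -> v z = (fine (v z))%:E.
  move=> /vb/andP[h1 h2]; rewrite fineK// fin_numE.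
  by apply/andP; split; apply/eqP => e; rewrite e ?leeNe_eq ?leye_eq in h1 h2.
apply/subsolutionP; split=> [z [Gz _]||psi z1 C2 [Gz1 zt] vmax]; first exact: vfin.
  move=> z [Gz zt] a /(vusc z Gz) near.
  have {}near : \forall y \near z, G y -> (v y < a%:E)%E := near.
  suff : \forall y \near z, before t0 G y -> (v y < a%:E)%E by [].
  by apply: filterS near => y H [/H].
(* Two times strictly between that of [z1] and [t0]: the cutoff is 1 before [r1], hence near [z1],
   and 0 after [r2], hence before [t0] is reached. *)
pose r1 := (z1.2 + z1.2 + t0) / 3; pose r2 := (z1.2 + t0 + t0) / 3.
have [zr1 r12 r2t] : [/\ z1.2 < r1, r1 < r2 & r2 < t0].
  by split; rewrite /r1 /r2; lra.
have [chi [chi1 [chi2 [d1 d2 c2 c01 [chi_1 chi_0]]]]] := exists_cutoff r12.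
(* The constant for which v - N <= v z1 - psi z1 follows from v <= M. Then [phi], a convex
   combination of [psi] and [N], keeps the maximum at [z1]. *)
pose N := M - (fine (v z1) - psi z1).
pose phi z := if z.2 < t0 then chi z.2 * psi z + (1 - chi z.2) * N else N.
have DB := C2_on_data oB C2.
have Dchi : C2_data (before t0 G) (fun z => chi z.2) (fun k z => if k is None then chi1 z.2 else 0)
    (fun k l z => if (k, l) is (None, None) then chi2 z.2 else 0).
  by apply: (C2_data_time (h := chi) (h1 := chi1) (h2 := chi2)) => z _; exact: c2.
have C2phi : C2_on G phi.
  apply: C2_on_local => // z Gz; have [zt'|zt'] := ltP z.2 t0.
    exists (before t0 G); split; [exact: oB|by split|].
    have D := C2_data_add (C2_data_mul Dchi DB)
      (C2_data_mul (C2_data_add (@C2_data_cst _ _ (before t0 G) 1) (C2_data_opp Dchi))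
        (@C2_data_cst _ _ (before t0 G) N)).
    apply: (C2_data_on oB).
    apply: C2_data_eq D => [|y [_ yt]|k y _|k l y _]; [exact: oB| |exact: erefl|exact: erefl].
    by rewrite /phi yt.
  have oA : open (G `&` [set y | r2 < y.2]).
    apply: openI => //.
    apply: (@open_comp _ _ (snd : pt -> R) [set t | r2 < t]); last exact: open_gt.
    by move=> y _; exact: cvg_snd.
  exists (G `&` [set y | r2 < y.2]); split; [exact: oA|by split=> //=; exact: lt_le_trans zt'|].
  apply: (C2_data_on oA).
  apply: C2_data_eq (@C2_data_cst _ _ _ N) => [|y [_ /= yt]||]; first exact: oA.
  - by rewrite /phi; case: ifP => // _; rewrite chi_0 ?ltW// mul0r subr0 mul1r add0r.
  - by [].
  - by [].
have oU : open (before r1 G) by exact: open_before.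
have sU : before r1 G `<=` before t0 G.
  by move=> y [Gy yt]; split=> //; apply: lt_trans yt (lt_trans r12 r2t).
have Uz1 : before r1 G z1 by split.
have phiE y : before r1 G y -> psi y = phi y.
  move=> /[dup] /sU[_ yt'] [_ yt]; rewrite /phi yt' chi_1 ?(ltW yt)//.
  by rewrite subrr mul0r mul1r addr0.
have D1 := C2_on_data oU (C2_onW sU C2).
have D2 := C2_data_eq oU phiE (fun k z _ => erefl _) (fun k l z _ => erefl _) D1.
have := vs phi z1 C2phi Gz1.
have phi_max y : G y -> (v y - (phi y)%:E <= v z1 - (phi z1)%:E)%E.
  move=> Gy; rewrite -(phiE z1)// (vE y)// (vE z1)// -!EFinD lee_fin.
  have fM : fine (v y) <= M by have := vb y Gy; rewrite vE// lee_fin => /andP[].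
  rewrite /phi; have [yt|yt] := ltP y.2 t0; last by rewrite /N; lra.
  have := vmax y (conj Gy yt); rewrite (vE y)// (vE z1)// -!EFinD lee_fin => K1.
  have /andP[x0 x1] := c01 y.2; rewrite /N.
  have A1 : chi y.2 * (fine (v y) - psi y) <= chi y.2 * (fine (v z1) - psi z1) by rewrite ler_wpM2l.
  have A2 : (1 - chi y.2) * fine (v y) <= (1 - chi y.2) * M by rewrite ler_wpM2l// subr_ge0.
  lra.
move=> /(_ phi_max); apply: visc_at_eq.
- by rewrite (gradE D1 Uz1) (gradE D2 Uz1).
- by rewrite (hessE oU D1 Uz1) (hessE oU D2 Uz1).
- by rewrite (time_derivE D1 Uz1) (time_derivE D2 Uz1).
Qed.

End Subsolutions.

(** * Upper semicontinuous envelopes of families of subsolutions *)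

Section Perron.
Set Implicit Arguments.
Unset Strict Implicit.
Context {R : realType} {n : nat}.
Notation pt := ('rV[R]_n * R)%type.
Implicit Types (G : set pt) (psi : pt -> R) (z : pt) (a b c d : R) (u v : pt -> \bar R)
  (S : set (pt -> \bar R)).

(** Squared Euclidean distance in space-time: smooth, itself a barrier, and its sublevel sets form a
    neighbourhood base at [z0]. *)
Definition sqdist (z0 z : pt) : R := sqnorm (z.1 - z0.1) + (z.2 - z0.2) ^+ 2.

Lemma barrierE z0 a b c d z : barrier z0 a b c d z =
  d + a * sqnorm (z.1 - z0.1) + b * (z.2 - z0.2) + c * (z.2 - z0.2) ^+ 2.
Proof.
rewrite /barrier /quadratic /parabola.
have -> : sqnorm (z.1 - z0.1) = \sum_i (z.1 0 i - z0.1 0 i) ^+ 2.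
  by apply: eq_bigr => i _; rewrite !mxE.
by move: (\sum_i _) => s; ring.
Qed.

Lemma sqdistE z0 eta z : barrier z0 eta 0 eta 0 z = eta * sqdist z0 z.
Proof. by rewrite barrierE /sqdist mul0r addr0 add0r mulrDr. Qed.

Lemma sqdistxx z0 : sqdist z0 z0 = 0.
Proof.
by rewrite /sqdist !subrr expr0n addr0; apply/eqP; rewrite sqnorm_eq0.
Qed.

Lemma continuous_sqdist z0 : continuous (sqdist z0).
Proof.
have -> : sqdist z0 = barrier z0 1 0 1 0 by apply/funext => z; rewrite sqdistE mul1r.
exact: continuous_barrier.
Qed.

Lemma sqdist_nbhs (P : set pt) z0 : nbhs z0 P ->
  exists2 rho : R, 0 < rho & forall z, sqdist z0 z < rho -> P z.
Proof.
move=> /nbhs_ballP[e /= e0 He]; exists ((e / 2) ^+ 2); first by rewrite exprn_gt0// divr_gt0.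
move=> z zr; apply: He.
have e20 : 0 < e / 2 by rewrite divr_gt0.
have e2e : e / 2 < e by rewrite ltr_pdivrMr// ltr_pMr// ltr1n.
have key (x : R) : x ^+ 2 <= sqdist z0 z -> `|x| < e.
  move=> /le_lt_trans/(_ zr) h; apply: lt_trans e2e.
  by rewrite -(@ltr_pXn2r _ 2)// ?nnegrE// ?ltW// -normrX ger0_norm// sqr_ge0.
split; rewrite -ball_normE /ball_/= distrC.
  apply: le_lt_trans e2e; apply: rV_norm_le; first exact: ltW.
  move=> i; rewrite -(@ler_pXn2r _ 2)// ?nnegrE// ?ltW// -normrX ger0_norm ?sqr_ge0//.
  by apply: le_lt_trans zr; apply: le_trans (coord_sqr_le _ _) _; rewrite lerDl sqr_ge0.
by apply: key; rewrite lerDr sqnorm_ge0.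
Qed.

(** The neighbourhoods are not punctured, so at points of [G] the envelope dominates every member of
    the family. *)
Definition usc_env G S z : \bar R :=
  limf_esup (fun y => ereal_sup [set v y | v in S]) (within G (nbhs z)).

Lemma usc_env_ge G S v z : G z -> S v -> (v z <= usc_env G S z)%E.
Proof.
move=> Gz Sv; apply: le_ereal_inf_tmp => _ [V FV <-].
apply: (@le_trans _ _ (ereal_sup [set v z | v in S])).
  by apply: ereal_sup_ubound; exists v.
apply: ereal_sup_ubound; exists z => //.
exact: (nbhs_singleton FV).
Qed.

Lemma usc_env_le G S psi z : {for z, continuous psi} ->
  (forall v y, S v -> G y -> (v y <= (psi y)%:E)%E) -> (usc_env G S z <= (psi z)%:E)%E.
Proof.
move=> cpsi H; apply/limf_esup_leP => a la.
have near : \forall y \near z, psi y < a by apply: (cvgr_lt _ cpsi).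
suff : \forall y \near z, G y -> (ereal_sup [set v y | v in S] < a%:E)%E by [].
apply: filterS near => y ya Gy; apply: le_lt_trans (_ : (psi y)%:E < _)%E.
  by apply: ge_ereal_sup => _ [v Sv <-]; exact: H.
by rewrite lte_fin.
Qed.

Lemma usc_on_usc_env G S : usc_on G (usc_env G S).
Proof.
move=> z Gz a /ereal_inf_lt[_ [V FV <-] sV].
have FV' : \forall y \near z, G y -> V y := FV.
suff : \forall y \near z, G y -> (usc_env G S y < a%:E)%E by [].
apply: filterS (nbhs_interior FV') => y yV _.
by apply: le_lt_trans sV; apply: ereal_inf_lbound; exists V.
Qed.

(* If a test function failed, a strict perturbation of it would touch a single
   member of the family at a nearby point where the perturbation still fails. *)
Lemma subsolution_usc_env G S (m M : R) : (0 < n)%N -> open G -> bounded_set G ->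
  (forall v, S v -> subsolution G v) ->
  (forall v z, S v -> G z -> (v z <= M%:E)%E) ->
  (exists2 v, S v & forall z, G z -> (m%:E <= v z)%E) ->
  subsolution G (usc_env G S).
Proof.
move=> n0 oG bG Ssub SM [vm Svm vmm].
have WM z : (usc_env G S z <= M%:E)%E.
  by apply: (usc_env_le (psi := fun=> M)) => //; exact: cst_continuous.
have Wm z : G z -> (m%:E <= usc_env G S z)%E.
  by move=> Gz; apply: le_trans (vmm z Gz) (usc_env_ge Gz Svm).
set W := usc_env G S in WM Wm *.
apply/subsolutionP; split=> [z _||psi z0 C2 Gz0 Wmax].
- by apply: le_lt_trans (WM z) _; rewrite ltry.
- exact: usc_on_usc_env.
have [w0 W0] : exists w : R, W z0 = w%:E.
  have := Wm z0 Gz0; have := WM z0; case: (W z0) => [r _ _| |]; first by exists r.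
    by rewrite leye_eq.
  by rewrite leeNy_eq.
apply: contrapT => nv.
have [eta eta0 nv'] := perturb_not_visc_at n0 oG C2 Gz0 nv.
set psi' := (fun z => _) in nv'.
have C2' : C2_on G psi'.
  exact: C2_data_on oG (C2_data_add (C2_on_data oG C2) (@C2_data_barrier _ _ G z0 eta 0 eta 0)).
have nG : \forall y \near z0, G y by exact: open_nbhs_nbhs.
have [rho rho0 Hrho] := sqdist_nbhs (filterI nG (near_not_visc_at n0 oG C2' Gz0 nv')).
pose r := rho / 2; have [r0 rrho] : 0 < r /\ r < rho by rewrite /r; split; lra.
have psi'E z : psi' z = psi z + eta * sqdist z0 z by rewrite /psi' sqdistE.
have psi'0 : psi' z0 = psi z0 by rewrite psi'E sqdistxx mulr0 addr0.
(* At squared distance more than [r] the perturbation costs more than eta * r, while the choice of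
   [y] and [v] loses less than 2 gap = eta * r / 2. *)
pose gap := eta * r / 4; have gap0 : 0 < gap by rewrite /gap divr_gt0// mulr_gt0.
have cpsi' : {for z0, continuous psi'} by have [] := C2_on_data oG C2' Gz0.
have n1 : \forall y \near z0, psi' y < psi' z0 + gap by apply: (cvgr_lt _ cpsi'); rewrite ltrDl.
have n2 : \forall y \near z0, sqdist z0 y < r.
  by apply: (cvgr_lt _ (@continuous_sqdist z0 z0)); rewrite sqdistxx.
pose A := [set y | G y /\ (psi' y < psi' z0 + gap /\ sqdist z0 y < r)].
(* The envelope at [z0] need not be approached by members at [z0] itself, only by members at points
   close to it. *)
have [y [Gy [y1 y2]] [v Sv vy]] : exists2 y, A y & exists2 v, S v & ((w0 - gap)%:E < v y)%E.
  have : ((w0 - gap)%:E < ereal_sup ((fun y => ereal_sup [set v y | v in S]) @` A))%E.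
    apply: (@lt_le_trans _ _ (W z0)); first by rewrite W0 lte_fin ltrBlDr ltrDl.
    apply: ereal_inf_lbound; exists A => //.
    suff : \forall y \near z0, G y -> A y by [].
    by apply: filterS2 n1 n2 => y ? ? ?.
  move=> /ereal_sup_gt[_ [y Ay <-]] /ereal_sup_gt[_ [v Sv <-] vy].
  by exists y => //; exists v.
pose K := [set z | sqdist z0 z <= r].
have KG z : K z -> G z /\ ~ visc_at psi' z by move=> /le_lt_trans/(_ rrho)/Hrho.
have cK : compact K.
  apply: (subclosed_compact _ (compact_closure_bounded bG)).
    apply: (@closed_comp _ _ (sqdist z0) [set s | s <= r]); last exact: closed_le.
    by move=> z _; exact: continuous_sqdist.
  by move=> z /KG[Gz _]; exact: subset_closure.
have /subsolutionP[_ vusc vs] := Ssub v Sv.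
have [||z1 Kz1 z1max] := @compact_usc_max R _ K (fun z => (v z - (psi' z)%:E)%E) _ cK.
- by exists y; exact: ltW.
- move=> z Kz a za; have [Gz _] := KG z Kz.
  have cz : {for z, continuous psi'} by have [] := C2_on_data oG C2' Gz.
  have : \forall y \near within G (nbhs z), (v y - (psi' y)%:E < a%:E)%E.
    by apply: near_lt_sub za; [exact: vusc|apply: cvg_within_filter; exact: cz].
  move=> near; have {}near : \forall y \near z, G y -> (v y - (psi' y)%:E < a%:E)%E := near.
  suff : \forall y \near z, K y -> (v y - (psi' y)%:E < a%:E)%E by [].
  by apply: filterS near => x Hx /KG[Gx _]; exact: Hx.
have [Gz1 nv1] := KG z1 Kz1; apply: nv1; apply: (vs _ _ C2' Gz1) => z Gz.
have [Kz|nKz] := pselect (K z); first exact: z1max.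
have zr : r < sqdist z0 z by rewrite ltNge; apply/negP.
(* Outside [K] the difference stays below its value at [y]; hence the maximum over [K] is global on
   [G], as the definition of subsolution demands. *)
apply: le_trans (z1max y (ltW y2)).
apply: (@le_trans _ _ (w0 - gap - (psi' z0 + gap))%:E).
  have := Wmax z Gz; rewrite W0 -EFinD => WmaxR.
  have vW := usc_env_ge Gz Sv.
  rewrite leeBlDr// -EFinD psi'0 psi'E.
  have : (v z <= (w0 - psi z0 + psi z)%:E)%E.
    by apply: le_trans vW _; move: WmaxR; rewrite leeBlDr.
  move=> /le_trans; apply; rewrite lee_fin /gap.
  have : eta * r < eta * sqdist z0 z by rewrite ltr_pM2l.
  by have := mulr_gt0 eta0 r0; lra.
rewrite EFinB; apply: leeB; first exact: ltW.
by rewrite lee_fin ltW.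
Qed.

End Perron.

(** * Maxima of subsolutions, and gluing across time t0 *)

Section Gluing.
Set Implicit Arguments.
Unset Strict Implicit.
Context {R : realType} {n : nat}.
Notation pt := ('rV[R]_n * R)%type.
Implicit Types (G : set pt) (psi f : pt -> R) (z : pt) (a b c d : R) (u v w : pt -> \bar R).

Lemma near_withinP (T : topologicalType) (G P : set T) (x : T) :
  (\forall y \near within G (nbhs x), P y) <-> (\forall y \near x, G y -> P y).
Proof. by []. Qed.

Lemma usc_on_continuous G psi : continuous psi -> usc_on G (EFin \o psi).
Proof.
move=> cpsi z Gz a; rewrite lte_fin => h; apply/near_withinP.
have near : \forall y \near z, psi y < a by apply: (cvgr_lt _ (cpsi z)).
by apply: filterS near => y ya _; rewrite lte_fin.
Qed.

(** The barrier has to be a subsolution only where it strictly exceeds [v]; elsewhere [v] itself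
    supports the maximum. This allows barriers that fail at early times. *)
Lemma subsolution_max_barrier G v z0 a b c d : (0 < n)%N -> open G ->
  subsolution G v ->
  (forall z, G z -> (v z < (barrier z0 a b c d z)%:E)%E ->
     b + 2 * c * (z.2 - z0.2) <= 2 * a) ->
  subsolution G (fun z => maxe (v z) (barrier z0 a b c d z)%:E).
Proof.
move=> n0 oG vsub Hab; have /subsolutionP[vfin vusc _] := vsub.
apply: subsolution_glue => // [z Gz|z Gz e|z Gz].
- by rewrite gt_max vfin//= ltry.
- rewrite gt_max => /andP[e1 e2].
  have H1 := vusc z Gz e e1.
  have H2 := usc_on_continuous (@continuous_barrier _ _ z0 a b c d) Gz e2.
  by apply: filterS2 H1 H2 => y y1 y2; rewrite gt_max y1.
have [le|lt] := leP (barrier z0 a b c d z)%:E (v z).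
  by left; exists G, v; split=> // y _; rewrite le_max lexx.
right; exists z0, a, b, c, d; split; [exact: Hab|by []|].
by near=> y; rewrite le_max lexx orbT.
Unshelve. all: by end_near. Qed.

Lemma barrier_cst z0 d z : barrier z0 0 0 0 d z = d.
Proof. by rewrite barrierE !mul0r !addr0. Qed.

Lemma subsolution_max_cst G v (m : R) : (0 < n)%N -> open G -> subsolution G v ->
  subsolution G (fun z => maxe (v z) m%:E).
Proof.
move=> n0 oG vsub.
have := @subsolution_max_barrier G v (0, 0) 0 0 0 m n0 oG vsub.
under eq_fun do rewrite barrier_cst; apply.
by move=> z _ _; rewrite !mulr0 mul0r addr0.
Qed.

Lemma subsolution_barrier G z0 a b c d : (0 < n)%N -> open G ->
  (forall z, G z -> b + 2 * c * (z.2 - z0.2) <= 2 * a) ->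
  subsolution G (EFin \o barrier z0 a b c d).
Proof.
move=> n0 oG Hab; apply: subsolution_glue => // [z _|z Gz|z Gz].
- by rewrite /= ltry.
- by apply: usc_on_continuous Gz; exact: continuous_barrier.
- by right; exists z0, a, b, c, d; split; [exact: Hab|by []|near=> y].
Unshelve. all: by end_near. Qed.

Lemma subsolution_cst G (m : R) : (0 < n)%N -> open G ->
  subsolution G (fun=> m%:E).
Proof.
move=> n0 oG.
have -> : (fun=> m%:E) = EFin \o @barrier R n (0, 0) 0 0 0 m.
  by apply/funext => z; rewrite /= barrier_cst.
by apply: subsolution_barrier => // z _; rewrite !mulr0 mul0r addr0.
Qed.

Lemma near_blowup (M a delta t0 : R) z : 0 < delta -> t0 <= z.2 ->
  \forall y \near z, y.2 < t0 -> ((M - delta / (t0 - y.2))%:E < a%:E)%E.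
Proof.
move=> d0 zt; pose eps := delta / (`|M - a| + 1).
have eps0 : 0 < eps by rewrite divr_gt0// ltr_wpDl.
have near : \forall y \near z, t0 - eps < y.2.
  have c2 : {for z, continuous (snd : pt -> R)} by exact: cvg_snd.
  by apply: (cvgr_gt _ c2); rewrite ltrBlDr (le_lt_trans zt)// ltrDl.
apply: filterS near => y yeps yt; have tpos : 0 < t0 - y.2 by rewrite subr_gt0.
rewrite lte_fin ltrBlDr -ltrBlDl ltr_pdivlMr//.
apply: (@le_lt_trans _ _ (`|M - a| * (t0 - y.2))).
  by rewrite ler_wpM2r ?ler_norm// ltW.
have : t0 - y.2 < eps by lra.
rewrite /eps ltr_pdivlMr ?ltr_wpDl// mulrDr mulr1 => h.
by rewrite mulrC; lra.
Qed.

Definition past_max (t0 delta : R) u w z : \bar R :=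
  if z.2 < t0 then maxe (u z - (delta / (t0 - z.2))%:E)%E (w z) else w z.

Lemma past_max_ge t0 delta u w z : (w z <= past_max t0 delta u w z)%E.
Proof. by rewrite /past_max; case: ifP => // _; rewrite le_max lexx orbT. Qed.

(* The penalisation sends the first function to -oo at time t0, so that it is
   swallowed by [w] before reaching t0. *)
Lemma subsolution_past_max G u w (t0 delta M : R) : (0 < n)%N -> open G -> 0 < delta ->
  subsolution (before t0 G) u -> (forall z, before t0 G z -> (u z <= M%:E)%E) ->
  subsolution G w -> subsolution G (past_max t0 delta u w).
Proof.
move=> n0 oG d0 usub uM wsub.
have oB : open (before t0 G) by exact: open_before.
have usub' : subsolution (before t0 G) (fun z => (u z - (delta / (t0 - z.2))%:E)%E).
  by apply: subsolution_sub_blowup => //; [exact: ltW|by move=> z []].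
have /subsolutionP[wfin wusc _] := wsub.
have /subsolutionP[ufin' uusc' _] := usub'.
apply: subsolution_glue => // [z Gz|z Gz a|z Gz].
- by rewrite /past_max; case: ifP => zt; rewrite ?gt_max ?wfin// andbT; exact: ufin'.
- move=> za; have wa : (w z < a%:E)%E by apply: le_lt_trans (past_max_ge _ _ _ _ _) za.
  have Hw := wusc z Gz a wa.
  suff Hu : \forall y \near within G (nbhs z),
      y.2 < t0 -> (u y - (delta / (t0 - y.2))%:E < a%:E)%E.
    apply: filterS2 Hw Hu => y wy uy; rewrite /past_max; case: ifP => // yt.
    by rewrite gt_max wy andbT; exact: uy.
  have nG : \forall y \near z, G y by exact: open_nbhs_nbhs.
  have [zt|zt] := ltP z.2 t0.
    have Bz : before t0 G z by split.
    have ua : (u z - (delta / (t0 - z.2))%:E < a%:E)%E.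
      by move: za; rewrite /past_max zt gt_max => /andP[].
    have /near_withinP Hu := uusc' z Bz a ua.
    by apply/near_withinP; apply: filterS Hu => y Hy Gy yt; apply: Hy.
  apply/near_withinP; apply: filterS (near_blowup M a d0 zt) => y Hy Gy yt.
  apply: le_lt_trans (Hy yt); rewrite EFinB; apply: leeB => //; exact: uM.
have [pw|npw] := eqVneq (past_max t0 delta u w z) (w z).
  left; exists G, w; split=> // y _; exact: past_max_ge.
left; have zt : z.2 < t0.
  by move: npw; rewrite /past_max; case: ifP => //; rewrite eqxx.
exists (before t0 G), (fun z => (u z - (delta / (t0 - z.2))%:E)%E); split=> //.
- by move=> y [].
- move: npw; rewrite /past_max zt; case: leP => //; by rewrite eqxx.
- by move=> y [_ yt]; rewrite /past_max yt le_max lexx.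
Qed.

End Gluing.

(** * Boundary behaviour, and barriers fitted to boundary data *)

Section PerronComparison.
Set Implicit Arguments.
Unset Strict Implicit.
Context {R : realType} {n : nat}.
Notation pt := ('rV[R]_n * R)%type.
Implicit Types (G : set pt) (psi f g : pt -> R) (z : pt) (a b c d : R) (u v w : pt -> \bar R).

Lemma compact_bound (T : topologicalType) (K : set T) (f : T -> R) :
  compact K -> {within K, continuous f} -> exists M, forall x, K x -> `|f x| <= M.
Proof.
move=> cK cf; have [M [_ HM]] := compact_bounded (continuous_compact cf cK).
exists (M + 1) => x Kx; apply: HM; first by rewrite ltrDl.
by exists x.
Qed.

Lemma compact_boundary G : bounded_set G -> compact (boundary G).
Proof.
move=> bG; apply: (subclosed_compact _ (compact_closure_bounded bG)); last by move=> z [].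
apply: closedI; first exact: closed_closure.
by rewrite closedC; exact: open_interior.
Qed.

Lemma limf_esup_le_continuous G v psi z : {for z, continuous psi} ->
  (forall y, G y -> (v y <= (psi y)%:E)%E) ->
  (limf_esup v (within G (nbhs z)) <= (psi z)%:E)%E.
Proof.
move=> cpsi H; apply/limf_esup_leP => a la; apply/near_withinP.
have near : \forall y \near z, psi y < a by apply: (cvgr_lt _ cpsi).
by apply: filterS near => y ya Gy; apply: le_lt_trans (H y Gy) _; rewrite lte_fin.
Qed.

Lemma limf_esup_cst_le G z (m l : R) : m <= l ->
  (limf_esup (fun=> m%:E) (within G (nbhs z)) <= l%:E)%E.
Proof.
move=> ml; apply/limf_esup_leP => a la; apply: filterE => y.
by rewrite lte_fin; exact: le_lt_trans ml la.
Qed.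

Lemma limf_esup_max_le G v w z (l : R) :
  (limf_esup v (within G (nbhs z)) <= l%:E)%E ->
  (limf_esup w (within G (nbhs z)) <= l%:E)%E ->
  (limf_esup (fun y => maxe (v y) (w y)) (within G (nbhs z)) <= l%:E)%E.
Proof.
move=> /limf_esup_leP Hv /limf_esup_leP Hw; apply/limf_esup_leP => a la.
by apply: filterS2 (Hv a la) (Hw a la) => y va wa; rewrite gt_max va.
Qed.

Lemma boundary_before G (t0 : R) z : open G -> boundary G z -> closure (before t0 G) z ->
  boundary (before t0 G) z.
Proof.
move=> oG /(boundary_openP _ oG)[_ nGz] cz.
by apply/(boundary_openP _ (open_before oG)); split=> // -[].
Qed.

(** A boundary point of [G] need not be one of [before t0 G]; in that case a neighbourhood misses
    the latter set and nothing is to be shown. *)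
Lemma near_before_lt G u (t0 l a : R) z : open G -> boundary G z ->
  (boundary (before t0 G) z -> (limf_esup u (within (before t0 G) (nbhs z)) <= l%:E)%E) ->
  l < a -> \forall y \near within G (nbhs z), y.2 < t0 -> (u y < a%:E)%E.
Proof.
move=> oG bz H la; apply/near_withinP.
have [cz|ncz] := pselect (closure (before t0 G) z).
  have /limf_esup_leP/(_ a la)/near_withinP := H (boundary_before oG bz cz).
  by apply: filterS => y Hy Gy yt; exact: Hy.
have oC : open (~` closure (before t0 G)) by rewrite openC; exact: closed_closure.
have : nbhs z (~` closure (before t0 G)) by exact: open_nbhs_nbhs.
by apply: filterS => y ny Gy yt; case: ny; apply: subset_closure.
Qed.

Lemma limf_esup_past_max_le G u w (t0 delta l : R) z : open G -> 0 <= delta -> boundary G z ->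
  (boundary (before t0 G) z -> (limf_esup u (within (before t0 G) (nbhs z)) <= l%:E)%E) ->
  (limf_esup w (within G (nbhs z)) <= l%:E)%E ->
  (limf_esup (past_max t0 delta u w) (within G (nbhs z)) <= l%:E)%E.
Proof.
move=> oG d0 bz Hu /limf_esup_leP Hw; apply/limf_esup_leP => a la.
apply: filterS2 (near_before_lt oG bz Hu la) (Hw a la) => y uy wy.
rewrite /past_max; case: ifP => // yt; rewrite gt_max wy andbT.
apply: le_lt_trans (uy yt); rewrite leeBlDr// leeDl// lee_fin.
by rewrite divr_ge0// subr_ge0 ltW.
Qed.

Lemma lower_perron_ge G f v z : lower_class G f v -> (v z <= lower_perron G f z)%E.
Proof. by move=> Lv; apply: ereal_sup_ubound; exists v. Qed.

Lemma lower_perron_le G f (x : \bar R) z :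
  (forall v, lower_class G f v -> (v z <= x)%E) -> (lower_perron G f z <= x)%E.
Proof. by move=> H; apply: ge_ereal_sup => _ [v Lv <-]; exact: H. Qed.

Lemma cvg_ereal_epsP (T : Type) (F : set_system T) (h : T -> \bar R) (l : R) : Filter F ->
  h @ F --> l%:E <->
  (forall e : R, 0 < e -> \forall x \near F, ((l - e)%:E <= h x <= (l + e)%:E)%E).
Proof.
move=> FF; split=> [cv e e0|H].
  apply: (cv [set y | ((l - e)%:E <= y <= (l + e)%:E)%E]).
  suff : nbhs l (fun r : R => ((l - e)%:E <= r%:E <= (l + e)%:E)%E) by [].
  apply/nbhs_ballP; exists e => //= r; rewrite -ball_normE /ball_/= !lee_fin.
  by rewrite distrC ltr_norml => /andP[? ?]; apply/andP; split; lra.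
move=> A nA; have {nA} : nbhs l (fun r : R => A r%:E) := nA.
move=> /nbhs_ballP[e /= e0 He].
apply: filterS (H (e / 2) (divr_gt0 e0 (ltr0n R 2))) => x.
case E : (h x) => [r| |]; rewrite ?lee_fin ?leye_eq ?leeNy_eq ?andbF//.
move=> /andP[h1 h2]; rewrite /preimage/= E; apply: He.
by rewrite -ball_normE /ball_/= ltr_norml; apply/andP; split; lra.
Qed.

Lemma bounded_before G (t0 : R) : bounded_set G -> bounded_set (before t0 G).
Proof. by move=> [M [rM HM]]; exists M; split=> // N MN z [Gz _]; exact: (HM N MN). Qed.

Lemma barrier_self (z0 : pt) a b c d : barrier z0 a b c d z0 = d.
Proof.
rewrite barrierE !subrr expr0n !mulr0 !addr0.
by rewrite (eqP (_ : sqnorm 0 == 0)) ?sqnorm_eq0// mulr0 addr0.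
Qed.

Lemma barrier_shift (z0 : pt) a b c d z : barrier z0 a b c d z = d + barrier z0 a b c 0 z.
Proof. by rewrite !barrierE; ring. Qed.

Lemma barrier_opp (z0 : pt) a b c d z :
  barrier z0 (- a) (- b) (- c) d z = d - barrier z0 a b c 0 z.
Proof. by rewrite !barrierE; ring. Qed.

(** With this c, the time derivative 2 A c (t - t0) of A c (t - t0)^2 is smaller in absolute value
    than the spatial contribution 2A, so the signs in [strict_barrier] hold on all of [G]. *)
Lemma exists_time_scale G (z0 : pt) : bounded_set G ->
  exists2 c, 0 < c & forall z, G z -> c * `|z.2 - z0.2| < 1.
Proof.
move=> bG; have [|M HM] := @compact_bound _ (closure G) (fun z : pt => z.2 - z0.2)
  (compact_closure_bounded bG).
  apply: continuous_subspaceT => z.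
  by apply: continuousB; [exact: cvg_snd|exact: cst_continuous].
exists (`|M| + 1)^-1; first by rewrite invr_gt0 ltr_wpDl.
move=> z Gz; rewrite ltr_pdivrMl ?ltr_wpDl// mulr1.
by rewrite (le_lt_trans (HM z (subset_closure Gz)))// (le_lt_trans (ler_norm M))// ltrDl.
Qed.

Lemma strict_barrier (z0 z : pt) (A c : R) : 0 < A -> 0 < c -> c * `|z.2 - z0.2| < 1 ->
  2 * - A < 0 + 2 * (- (A * c)) * (z.2 - z0.2) /\
  0 + 2 * (A * c) * (z.2 - z0.2) <= 2 * A.
Proof.
move=> A0 c0 h; have : c * (z.2 - z0.2) < 1.
  by apply: le_lt_trans h; rewrite ler_wpM2l ?ler_norm// ltW.
rewrite -(ltr_pM2l A0) mulr1; move: (z.2 - z0.2) => s h'; split; lra.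
Qed.

(** Reduces arbitrary continuous data to barriers. Near [z0] the margin [e] absorbs the variation of
    [f]; away from it, a large [A] absorbs the bound 2K on the oscillation. *)
Lemma barrier_fit G (z0 : pt) f (e c : R) : bounded_set G -> boundary G z0 ->
  {within boundary G, continuous f} -> 0 < e -> 0 < c ->
  exists2 A, 0 < A & forall z, boundary G z ->
    barrier z0 (- A) 0 (- (A * c)) (f z0 - e) z <= f z <=
    barrier z0 A 0 (A * c) (f z0 + e) z.
Proof.
move=> bG bz0 cf e0 c0.
have [K HK] := compact_bound (compact_boundary bG) cf.
have nf : \forall z \near z0, boundary G z -> `|f z0 - f z| < e.
  have := (subspace_continuousP _ _).1 cf z0 bz0.
  by move=> /cvgrPdist_lt/(_ e e0).
have [rho rho0 Hrho] := sqdist_nbhs nf.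
(* Then |x - x0|^2 + c (t - t0)^2 is at least k times the squared distance. *)
pose k := Num.min 1 c; have k0 : 0 < k by rewrite lt_min ltr01.
have K0 : 0 <= K by apply: le_trans (HK z0 bz0).
have [A A0 AE] : exists2 A, 0 < A & A * (k * rho) = 2 * K + 1.
  exists ((2 * K + 1) / (k * rho)); first by rewrite divr_gt0 ?mulr_gt0//; lra.
  by rewrite divfK// gt_eqF// mulr_gt0.
exists A => // z bz.
pose X := sqnorm (z.1 - z0.1); pose s := (z.2 - z0.2) ^+ 2.
have X0 : 0 <= X by exact: sqnorm_ge0.
have s0 : 0 <= s by exact: sqr_ge0.
have pos : 0 <= A * X + A * c * s.
  exact: addr_ge0 (mulr_ge0 (ltW A0) X0) (mulr_ge0 (mulr_ge0 (ltW A0) (ltW c0)) s0).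
rewrite !barrierE -/X -/s !mul0r !addr0.
have [lt|ge] := ltP (sqdist z0 z) rho.
  by have := Hrho z lt bz; rewrite ltr_norml => /andP[? ?]; apply/andP; split; lra.
have fz := HK z bz; have fz0 := HK z0 bz0.
move: fz fz0; rewrite !ler_norml => /andP[? ?] /andP[? ?].
suff : 2 * K + 1 <= A * X + A * c * s by move=> ?; apply/andP; split; lra.
have : k * rho <= X + c * s.
  apply: (@le_trans _ _ (k * sqdist z0 z)); first by rewrite ler_wpM2l// ltW.
  rewrite mulrDr lerD// ?ler_piMl// ?ge_min ?lexx//.
  by rewrite ler_wpM2r// ge_min lexx orbT.
rewrite -(ler_pM2l A0) AE => /le_trans; apply.
by rewrite mulrDr mulrA.
Qed.

(* Young's inequality absorbs the linear term b s into -e + C s^2. *)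
Lemma penalty (z0 : pt) (e D rho : R) : 0 < e -> 0 <= D -> 0 < rho ->
  exists a b C : R, [/\ 0 < C,
    forall z, - e <= barrier z0 a b C 0 z,
    forall z, rho <= sqdist z0 z -> D <= barrier z0 a b C 0 z &
    forall z, ~ (2 * a < b + 2 * C * (z.2 - z0.2)) -> z.2 - z0.2 <= - C^-1].
Proof.
move=> e0 D0 rho0.
(* Away from [z0] the barrier is at least 2 q rho - e = 2D + e. The 2 in [b] gives C (t - t0) <= -1
   wherever strictness fails. In [C], the first term pays for Young's inequality with C/2, the term
   4q leaves at least 2q in the other half, and 1 ensures positivity. *)
pose q := (D + e) / rho; have q0 : 0 < q by rewrite divr_gt0//; lra.
have qE : q * rho = D + e by rewrite divfK// gt_eqF.
pose a := 2 * q; pose b := 2 * a + 2.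
pose C := b ^+ 2 / (2 * e) + 4 * q + 1.
have p0 : 0 <= b ^+ 2 / (2 * e) by rewrite divr_ge0 ?sqr_ge0//; lra.
have C0 : 0 < C by rewrite /C; lra.
have bC : b ^+ 2 <= 2 * e * C.
  have : b ^+ 2 / (2 * e) <= C by rewrite /C; lra.
  by rewrite ler_pdivrMr ?mulr_gt0// mulrC.
have young (s : R) : - e <= b * s + C / 2 * s ^+ 2.
  have h : 0 <= (b + C * s) ^+ 2 by exact: sqr_ge0.
  have : 0 <= 2 * C * (b * s + C / 2 * s ^+ 2 + e) by lra.
  by rewrite pmulr_rge0 ?mulr_gt0//; lra.
exists a, b, C; split=> // z.
- rewrite barrierE; have := young (z.2 - z0.2).
  have := sqnorm_ge0 (z.1 - z0.1); have := sqr_ge0 (z.2 - z0.2).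
  move: (sqnorm _) (z.2 - z0.2) => X s s0 X0 y.
  have : 0 <= a * X by rewrite mulr_ge0// mulr_ge0// ltW.
  have : 0 <= C * s ^+ 2 by rewrite mulr_ge0// ltW.
  by lra.
- rewrite barrierE /sqdist; have := young (z.2 - z0.2).
  have := sqnorm_ge0 (z.1 - z0.1); have := sqr_ge0 (z.2 - z0.2).
  move: (sqnorm _) (z.2 - z0.2) => X s s0 X0 y h.
  have h1 : 2 * q * rho <= 2 * q * (X + s ^+ 2) by rewrite ler_wpM2l//; lra.
  have h2 : 4 * q * s ^+ 2 <= C * s ^+ 2 by rewrite ler_wpM2r// /C; lra.
  rewrite /a; lra.
- move=> /negP; rewrite -leNgt => h.
  have : C * (z.2 - z0.2) <= - 1 by rewrite /b in h; lra.
  by rewrite -ler_pdivlMl// mulrN1.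
Qed.

End PerronComparison.

(** * Regularity for Omega implies regularity for Omega_- *)

Section Regularity.
Set Implicit Arguments.
Unset Strict Implicit.
Context {R : realType} {n : nat}.
Notation pt := ('rV[R]_n * R)%type.
Implicit Types (G : set pt) (psi f g : pt -> R) (z : pt) (a b c d : R) (u v w : pt -> \bar R).

Variables (n0 : (0 < n)%N) (G : set pt) (z0 : pt).
Hypotheses (oG : open G) (bG : bounded_set G).
Let t0 := z0.2.
Let B := before t0 G.
Let oB : open B. Proof. exact: open_before. Qed.
Let bB : bounded_set B. Proof. exact: bounded_before. Qed.

Lemma continuous_bound_closure psi : continuous psi ->
  exists M, forall z, closure G z -> - M <= psi z <= M.
Proof.
move=> cpsi; have [M HM] := compact_bound (compact_closure_bounded bG)
  (continuous_subspaceT cpsi).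
by exists M => z /HM; rewrite ler_norml.
Qed.

Lemma lower_class_le_barrier G' f v (A c : R) d : open G' -> bounded_set G' ->
  0 < A -> 0 < c -> (forall z, G' z -> c * `|z.2 - z0.2| < 1) ->
  (forall z, boundary G' z -> f z <= barrier z0 (- A) 0 (- (A * c)) d z) ->
  lower_class G' f v -> forall z, G' z -> (v z <= (barrier z0 (- A) 0 (- (A * c)) d z)%:E)%E.
Proof.
move=> oG' bG' A0 c0 Hc fle [vsub vbd]; apply: comparison => // z.
  by move=> bz; apply: le_trans (vbd z bz) _; rewrite lee_fin; exact: fle.
by move=> Gz _; have [] := strict_barrier A0 c0 (Hc z Gz).
Qed.

Lemma lower_class_bounded G' f : open G' -> bounded_set G' -> G' `<=` G ->
  {within boundary G', continuous f} ->
  exists M, forall v z, lower_class G' f v -> G' z -> (v z <= M%:E)%E.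
Proof.
move=> oG' bG' sG cf; have [c c0 Hc] := exists_time_scale z0 bG'.
have [K HK] := compact_bound (compact_boundary bG') cf.
have [L HL] := continuous_bound_closure (@continuous_barrier _ _ z0 (- 1) 0 (- (1 * c)) 0).
(* The height K + L lifts a barrier of size at most [L] above data bounded by [K]; the second [L]
   bounds the lifted barrier from above. *)
exists (K + L + L) => v z Lv Gz.
have := @lower_class_le_barrier G' f v 1 c (K + L) oG' bG' ltr01 c0 Hc _ Lv z Gz.
move=> H; apply: le_trans (H _) _ => [y by_|].
  rewrite barrier_shift.
  have /HL/andP[h1 h2] : closure G y by apply: closure_subset sG _ _; case: by_.
  by have := HK y by_; rewrite ler_norml => /andP[? ?]; lra.
rewrite lee_fin barrier_shift.
have /HL/andP[h1 h2] : closure G z by apply: subset_closure; exact: sG.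
lra.
Qed.

Lemma lower_class_max_cst G' f v (m : R) : open G' -> lower_class G' f v ->
  (forall z, boundary G' z -> m <= f z) ->
  lower_class G' f (fun z => maxe (v z) m%:E).
Proof.
move=> oG' [vsub vbd] mf; split; first exact: subsolution_max_cst.
move=> z bz; apply: limf_esup_max_le; first exact: vbd.
by apply: limf_esup_cst_le; exact: mf.
Qed.

(** At boundary points of [B] lying inside [G] the lower class of [G] prescribes nothing. Taking a
    supersolution [Q] as data supplies the bound v <= Q there, by comparison on [G]. *)
Lemma lower_perron_restrict g (A c : R) d : 0 < A -> 0 < c ->
  (forall z, G z -> c * `|z.2 - z0.2| < 1) ->
  let Q := barrier z0 (- A) 0 (- (A * c)) d in
  (forall z, boundary B z -> Q z <= g z) ->
  forall z, B z -> (lower_perron G Q z <= lower_perron B g z)%E.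
Proof.
move=> A0 c0 Hc Q Qg z Bz; apply: lower_perron_le => v Lv.
have [M HM] := continuous_bound_closure (@continuous_barrier _ _ z0 (- A) 0 (- (A * c)) d).
have vQ y : G y -> (v y <= (Q y)%:E)%E by apply: (lower_class_le_barrier oG bG A0 c0 Hc _ Lv).
(* Restriction to [B] requires bounds on both sides; since -M <= Q, the truncation stays below
   [Q]. *)
pose v' z := maxe (v z) (- M)%:E.
have v'Q y : G y -> (v' y <= (Q y)%:E)%E.
  move=> Gy; rewrite ge_max vQ//= lee_fin.
  by have /andP[] := HM y (subset_closure Gy).
apply: (@le_trans _ _ (v' z)); first by rewrite le_max lexx.
apply: lower_perron_ge; split.
  apply: (@subsolution_before _ _ _ _ _ (- M) M) => //.
    by apply: subsolution_max_cst => //; case: Lv.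
  move=> y Gy; rewrite le_max lexx orbT/=.
  apply: le_trans (v'Q y Gy) _; rewrite lee_fin.
  by have /andP[] := HM y (subset_closure Gy).
move=> y by_; apply: (@le_trans _ _ (Q y)%:E); last by rewrite lee_fin Qg.
apply: limf_esup_le_continuous; first exact: continuous_barrier.
by move=> x [Gx _]; exact: v'Q.
Qed.

Lemma lee_sub_epsP (x y : \bar R) :
  (forall e : R, 0 < e -> (x - e%:E <= y)%E) -> (x <= y)%E.
Proof.
by move=> H; apply/lee_addgt0Pr => e e0; have := H e e0; rewrite leeBlDr.
Qed.

Lemma lower_perron_extend g (A c : R) d : 0 < A -> 0 < c ->
  (forall z, G z -> c * `|z.2 - z0.2| < 1) ->
  {within boundary B, continuous g} ->
  let Q := barrier z0 A 0 (A * c) d in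
  (forall z, boundary B z -> g z <= Q z) ->
  forall z, B z -> (lower_perron B g z <= lower_perron G Q z)%E.
Proof.
move=> A0 c0 Hc cg Q gQ z [Gz zt]; apply: lower_perron_le => v Lv.
have [M HM] := lower_class_bounded oB bB (fun y => @proj1 _ _) cg.
apply: lee_sub_epsP => e e0.
have tz : 0 < t0 - z.2 by rewrite subr_gt0.
(* Depends on the point [z], so that the penalisation there is exactly [e]. *)
pose delta := e * (t0 - z.2); have d0 : 0 < delta by rewrite mulr_gt0.
apply: (@le_trans _ _ (past_max t0 delta v (EFin \o Q) z)).
  by rewrite /past_max zt le_max /delta mulfK ?lexx// gt_eqF.
have [vsub vbd] := Lv.
apply: lower_perron_ge; split.
  apply: subsolution_past_max => //; first by move=> y By; exact: HM Lv By.
  by apply: subsolution_barrier => // y Gy; have [] := strict_barrier A0 c0 (Hc y Gy).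
move=> y by_; apply: limf_esup_past_max_le => //; first exact: ltW.
  by move=> bBy; apply: le_trans (vbd y bBy) _; rewrite lee_fin gQ.
by apply: limf_esup_le_continuous => //; exact: continuous_barrier.
Qed.

(** Here [psi] need not be a supersolution: at boundary points of [B] inside [G] the penalisation
    drives the restricted function to -oo, so any value of [psi] is respected. *)
Lemma lower_perron_le_before f psi : {within boundary G, continuous f} ->
  continuous psi -> (forall z, boundary G z -> f z <= psi z) ->
  forall z, B z -> (lower_perron G f z <= lower_perron B psi z)%E.
Proof.
move=> cf cpsi fpsi z [Gz zt]; apply: lower_perron_le => v Lv.
have [M HM] := lower_class_bounded oG bG (fun y => id) cf.
have [L HL] := continuous_bound_closure cpsi.
have [K HK] := compact_bound (compact_boundary bG) cf.
pose m := - K; have mf y : boundary G y -> m <= f y.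
  by move=> /HK; rewrite ler_norml => /andP[].
have [v'sub v'bd] := lower_class_max_cst oG Lv mf.
set v' := (fun z => maxe _ _) in v'sub v'bd.
have v'M y : G y -> (v' y <= (Num.max M m)%:E)%E.
  by move=> Gy; rewrite EFin_max ge_max !le_max (HM v)//= lexx orbT.
apply: lee_sub_epsP => e e0.
have tz : 0 < t0 - z.2 by rewrite subr_gt0.
pose delta := e * (t0 - z.2); have d0 : 0 < delta by rewrite mulr_gt0.
apply: (@le_trans _ _ (v' z - (delta / (t0 - z.2))%:E)%E).
  by rewrite /delta mulfK ?gt_eqF//; apply: leeB => //; rewrite le_max lexx.
apply: (@lower_perron_ge _ _ _ _ (fun z => (v' z - (delta / (t0 - z.2))%:E)%E)); split.
  apply: subsolution_sub_blowup => //; [exact: ltW|by move=> y []|].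
  apply: (@subsolution_before _ _ _ _ _ m (Num.max M m)) => //.
  by move=> y Gy; rewrite v'M// andbT le_max lexx orbT.
move=> y by_; apply/limf_esup_leP => a la.
have [cy nBy] := (boundary_openP _ oB).1 by_.
have [Gy|nGy] := pselect (G y).
  have yt : t0 <= y.2 by rewrite leNgt; apply/negP => yt; apply: nBy.
  apply/near_withinP; apply: filterS (near_blowup (Num.max M m) a d0 yt) => x Hx [Gx xt].
  by apply: le_lt_trans (Hx xt); rewrite EFinB; apply: leeB => //; exact: v'M.
have bGy : boundary G y.
  by apply/boundary_openP => //; split=> //; apply: closure_subset cy => x [].
have fa : f y < a by apply: le_lt_trans (fpsi y bGy) la.
have /limf_esup_leP/(_ a fa)/near_withinP H := v'bd y bGy.
apply/near_withinP; apply: filterS H => x Hx [Gx xt].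
apply: le_lt_trans (Hx Gx); rewrite leeBlDr// leeDl// lee_fin.
by rewrite divr_ge0 ?(ltW d0)// subr_ge0 ltW.
Qed.

Lemma near_before_within (P : set pt) z : (\forall y \near within G (nbhs z), P y) ->
  \forall y \near within B (nbhs z), P y.
Proof.
by move=> /near_withinP H; apply/near_withinP; apply: filterS H => y Hy [/Hy].
Qed.

Lemma near_perron G' f (e : R) : regular_boundary_point G' z0 ->
  {within boundary G', continuous f} -> 0 < e ->
  \forall z \near within G' (nbhs z0),
    ((f z0 - e)%:E <= lower_perron G' f z <= (f z0 + e)%:E)%E.
Proof. by move=> [_ H] cf; exact: (cvg_ereal_epsP _ _ _).1 (H f cf) e. Qed.

Lemma continuous_within (K : set pt) a b c d : {within K, continuous (barrier z0 a b c d)}.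
Proof. by apply: continuous_subspaceT; exact: continuous_barrier. Qed.

(** The data [g] are continuous only on the boundary of [B]. The fitted barriers are continuous
    everywhere, so regularity for [G] can be applied to them. *)
Lemma regular_before : regular_boundary_point G z0 -> boundary B z0 ->
  regular_boundary_point B z0.
Proof.
move=> reg bz0; split=> // g cg.
have [c c0 Hc] := exists_time_scale z0 bG.
apply/cvg_ereal_epsP => e e0; have e20 : 0 < e / 2 by rewrite divr_gt0.
have [A A0 HA] := barrier_fit bB bz0 cg e20 c0.
have H1 := near_before_within (near_perron reg
  (@continuous_within _ (- A) 0 (- (A * c)) (g z0 - e / 2)) e20).
have H2 := near_before_within (near_perron reg
  (@continuous_within _ A 0 (A * c) (g z0 + e / 2)) e20).
have HB : \forall z \near within B (nbhs z0), B z by apply/near_withinP; near=> y.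
apply: filterS3 H1 H2 HB => z; rewrite !barrier_self => /andP[h1 _] /andP[_ h2] Bz.
apply/andP; split.
  apply: (@le_trans _ _ (g z0 - e / 2 - e / 2)%:E); first by rewrite lee_fin; lra.
  apply: le_trans h1 _; apply: lower_perron_restrict => // y by_.
  by have /andP[] := HA y by_.
apply: (@le_trans _ _ (g z0 + e / 2 + e / 2)%:E); last by rewrite lee_fin; lra.
apply: le_trans h2; apply: lower_perron_extend => // y by_.
by have /andP[] := HA y by_.
Unshelve. all: by end_near. Qed.

End Regularity.

(** * Regularity for Omega from control of Omega_- near z0 *)

Section RegularityConverse.
Set Implicit Arguments.
Unset Strict Implicit.
Context {R : realType} {n : nat}.
Notation pt := ('rV[R]_n * R)%type.
Implicit Types (psi f g : pt -> R) (z : pt) (a b c d : R) (u v w : pt -> \bar R).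

Variables (n0 : (0 < n)%N) (G : set pt) (z0 : pt).
Hypotheses (oG : open G) (bG : bounded_set G) (bz0 : boundary G z0).
Let t0 := z0.2.
Let B := before t0 G.
Let oB : open B. Proof. exact: open_before. Qed.
Let bB : bounded_set B. Proof. exact: bounded_before. Qed.

Hypothesis reg : regular_boundary_point B z0 \/ ~ boundary B z0.

(** Makes the second alternative of [reg] vacuous: every estimate required on [B] near [z0] holds
    trivially. *)
Lemma near_not_before : ~ boundary B z0 -> \forall z \near z0, ~ B z.
Proof.
move=> nb; have ncz : ~ closure B z0.
  by move=> cz; apply: nb; exact: boundary_before.
have oC : open (~` closure B) by rewrite openC; exact: closed_closure.
have : nbhs z0 (~` closure B) by exact: open_nbhs_nbhs.
by apply: filterS => z ncz' Bz; apply: ncz'; exact: subset_closure.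
Qed.

Lemma near_perron_le_before f (e : R) : {within boundary G, continuous f} -> 0 < e ->
  \forall z \near z0, B z -> (lower_perron G f z <= (f z0 + 2 * e)%:E)%E.
Proof.
move=> cf e0; case: reg => [rB|/near_not_before]; last exact: filterS.
have [c c0 Hc] := exists_time_scale z0 bG.
have [A A0 HA] := barrier_fit bG bz0 cf e0 c0.
have /near_withinP := near_perron rB (@continuous_within _ _ z0 _ A 0 (A * c) (f z0 + e)) e0.
apply: filterS => z Hz Bz; have /andP[_ +] := Hz Bz; rewrite barrier_self => h.
apply: (@le_trans _ _ (f z0 + e + e)%:E); last by rewrite lee_fin; lra.
apply: le_trans h; apply: (lower_perron_le_before n0 oG bG cf) => //.
  exact: continuous_barrier.
by move=> y /HA/andP[].
Qed.

(** The envelope dominates all competitors on [B] at once, so it inherits the lower bound that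
    regularity gives for their supremum. Comparison with [Q] survives in the envelope because [Q] is
    continuous. *)
Lemma exists_large_subsolution (A c e d : R) : 0 < A -> 0 < c -> 0 < e ->
  (forall z, G z -> c * `|z.2 - z0.2| < 1) ->
  let Q := barrier z0 (- A) 0 (- (A * c)) d in
  exists W : pt -> \bar R, [/\ subsolution B W,
    forall z, closure B z -> (limf_esup W (within B (nbhs z)) <= (Q z)%:E)%E,
    exists M : R, forall z, B z -> (W z <= M%:E)%E &
    \forall z \near z0, B z -> ((d - e)%:E <= W z)%E].
Proof.
move=> A0 c0 e0 Hc Q.
have HcB z : B z -> c * `|z.2 - z0.2| < 1 by move=> [Gz _]; exact: Hc.
have cQ : continuous Q by exact: continuous_barrier.
have [M HM] := continuous_bound_closure bG cQ.
have sB : closure B `<=` closure G by apply: closure_subset => z [].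
have Mcst : subsolution B (fun=> (- M)%:E) by exact: subsolution_cst.
have MQ z : closure B z -> - M <= Q z by move=> /sB/HM/andP[].
case: reg => [rB|nb]; last first.
  exists (fun=> (- M)%:E); split=> // [z cz||].
  - by apply: limf_esup_cst_le; exact: MQ.
  - by exists (- M).
  - exact: filterS (near_not_before nb).
pose S := lower_class B Q.
have SQ v z : S v -> B z -> (v z <= (Q z)%:E)%E.
  by move=> Sv; apply: (lower_class_le_barrier n0 oB bB A0 c0 HcB _ Sv).
have QM z : B z -> Q z <= M by move=> /subset_closure/sB/HM/andP[].
(* Membership of this constant keeps the envelope bounded below. *)
have Sm : S (fun=> (- M)%:E).
  split=> // z [cz _].
  by apply: limf_esup_cst_le; exact: MQ.
have WQ z : B z -> (usc_env B S z <= (Q z)%:E)%E.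
  by move=> Bz; apply: usc_env_le; [exact: cQ|move=> v y; exact: SQ].
exists (usc_env B S); split.
- apply: (@subsolution_usc_env _ _ _ _ (- M) M) => // [v []//|v z Sv Bz|].
    by apply: le_trans (SQ v z Sv Bz) _; rewrite lee_fin QM.
  by exists (fun=> (- M)%:E).
- by move=> z _; apply: limf_esup_le_continuous => //; exact: cQ.
- by exists M => z Bz; apply: le_trans (WQ z Bz) _; rewrite lee_fin QM.
have /near_withinP := near_perron rB (@continuous_within _ _ z0 _ (- A) 0 (- (A * c)) d) e0.
apply: filterS => z Hz Bz; have /andP[+ _] := Hz Bz; rewrite barrier_self => h.
apply: le_trans h _; apply: lower_perron_le => v Sv.
exact: usc_env_ge.
Qed.

Lemma near_boundary_close f (e : R) : {within boundary G, continuous f} -> 0 < e ->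
  \forall z \near z0, boundary G z -> f z0 - e <= f z <= f z0 + e.
Proof.
move=> cf e0; have /cvgrPdist_le/(_ e e0) := (subspace_continuousP _ _).1 cf z0 bz0.
move=> /near_withinP; apply: filterS => z Hz bz.
by have := Hz bz; rewrite distrC ler_distl.
Qed.

Lemma near_perron_le f (e : R) : {within boundary G, continuous f} -> 0 < e ->
  \forall z \near within G (nbhs z0), (lower_perron G f z <= (f z0 + 4 * e)%:E)%E.
Proof.
move=> cf e0.
have [rho rho0 Hrho] := sqdist_nbhs (filterI (near_boundary_close cf e0)
  (near_perron_le_before cf e0)).
have [K HK] := compact_bound (compact_boundary bG) cf.
have [M HM] := lower_class_bounded n0 z0 bG oG bG (fun y => id) cf.
(* Large enough for the barrier to exceed, away from [z0], both the data (bound [K]) and every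
   competitor inside [G] (bound [M]). *)
pose D := `|M| + `|K| + `|f z0|.
have D0 : 0 <= D by rewrite !addr_ge0.
have [a [b [C [C0 Pe PD Pt]]]] := penalty z0 e0 D0 rho0.
(* Since the penalty is at least -e, [Q] is at least f z0 + 2e, the bound known on [B] near [z0]. *)
pose Q := barrier z0 a b C (f z0 + 3 * e).
have QE z : Q z = f z0 + 3 * e + barrier z0 a b C 0 z by rewrite /Q barrier_shift.
have Dle : M <= f z0 + D /\ K <= f z0 + D.
  have := ler_norm M; have := ler_norm K; have := ler_norm (- f z0).
  by rewrite normrN /D; have := normr_ge0 M; have := normr_ge0 K; split; lra.
have far z : rho <= sqdist z0 z -> M <= Q z /\ K <= Q z.
  by move=> /PD; rewrite QE; lra.
have vQ v z : lower_class G f v -> G z -> (v z <= (Q z)%:E)%E.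
  move=> Lv; have [vsub vbd] := Lv; apply: comparison => // y.
    move=> by_; apply: le_trans (vbd y by_) _; rewrite lee_fin -/(Q y).
    have [lt|/far[_ KQ]] := ltP (sqdist z0 y) rho.
      have [/(_ by_)/andP[_ h] _] := Hrho y lt.
      by rewrite QE; have := Pe y; lra.
    by apply: le_trans KQ; have := HK y by_; rewrite ler_norml => /andP[].
  (* Where [Q] is not a strict supersolution, the point lies in [B], and there v <= Q is already
     known, contradicting [Qv]. *)
  rewrite -/(Q y) => Gy Qv; apply: contrapT => /Pt st.
  have Ci : 0 < C^-1 by rewrite invr_gt0.
  have By : B y by split=> //; rewrite /t0; lra.
  move: Qv; rewrite ltNge => /negP; apply.
  have [lt|/far[MQ _]] := ltP (sqdist z0 y) rho.
    have [_ /(_ By) h] := Hrho y lt.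
    apply: le_trans (lower_perron_ge _ Lv) (le_trans h _).
    by rewrite lee_fin QE; have := Pe y; lra.
  by apply: le_trans (HM v y Lv Gy) _; rewrite lee_fin.
have cQ : {for z0, continuous Q} by exact: continuous_barrier.
have near : \forall z \near z0, Q z < f z0 + 4 * e.
  by apply: (cvgr_lt _ cQ); rewrite /Q barrier_self; lra.
apply/near_withinP; apply: filterS near => z Qz Gz.
apply: lower_perron_le => v Lv; apply: le_trans (vQ v z Lv Gz) _.
by rewrite lee_fin ltW.
Qed.

Lemma near_perron_ge f (e : R) : {within boundary G, continuous f} -> 0 < e ->
  \forall z \near within G (nbhs z0), ((f z0 - 5 * e)%:E <= lower_perron G f z)%E.
Proof.
move=> cf e0.
have [c c0 Hc] := exists_time_scale z0 bG.
have [A A0 HA] := barrier_fit bG bz0 cf e0 c0.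
have [W [Wsub Wbd [M WM] Wnear]] := exists_large_subsolution (f z0 - e) A0 c0 e0 Hc.
have [rho rho0 Hrho] := sqdist_nbhs (filterI (near_boundary_close cf e0) Wnear).
have [K HK] := compact_bound (compact_boundary bG) cf.
pose D := `|K| + `|f z0|.
have D0 : 0 <= D by rewrite !addr_ge0.
have [a [b [C [C0 Pe PD Pt]]]] := penalty z0 e0 D0 rho0.
(* Near [z0], [W] is at least f z0 - 2e, its penalisation will cost at most [e], and [Q] is at most
   f z0 - 3e. *)
pose Q := barrier z0 (- a) (- b) (- C) (f z0 - 4 * e).
have QE z : Q z = f z0 - 4 * e - barrier z0 a b C 0 z by rewrite /Q barrier_opp.
have Dle : f z0 - D <= - K.
  by rewrite /D; have := ler_norm K; have := ler_norm (f z0); lra.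
have far z : rho <= sqdist z0 z -> Q z <= - K.
  by move=> /PD; rewrite QE; lra.
have Kf z : boundary G z -> - K <= f z by move=> /HK; rewrite ler_norml => /andP[].
(* At times t <= t0 - 1/C, the only ones where [Q] may fail to be a subsolution, delta / (t0 - t) is
   at most [e]. *)
pose delta := e / C; have d0 : 0 < delta by rewrite divr_gt0.
pose w := past_max t0 delta W (fun=> (- K)%:E).
have wsub : subsolution G w.
  by apply: subsolution_past_max WM _ => //; exact: subsolution_cst.
have Lv : lower_class G f (fun z => maxe (w z) (Q z)%:E).
  split.
    apply: subsolution_max_barrier => // z Gz; rewrite -/(Q z) => wQ.
    suff : 2 * a < b + 2 * C * (z.2 - z0.2) by lra.
    (* At the bad times [Q] never exceeds [w]: close to [z0] the penalised [W] dominates it,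
       elsewhere the constant -K does. *)
    apply: contrapT => /Pt st.
    have Ci : 0 < C^-1 by rewrite invr_gt0.
    have zt : z.2 < t0 by rewrite /t0; lra.
    move: wQ; rewrite ltNge => /negP; apply.
    have [lt|ge] := ltP (sqdist z0 z) rho; last first.
      apply: (@le_trans _ _ (- K)%:E); first by rewrite lee_fin; exact: far.
      exact: past_max_ge.
    have [_ /(_ (conj Gz zt)) h] := Hrho z lt.
    rewrite /w /past_max zt le_max; apply/orP; left.
    rewrite leeBrDr//; apply: le_trans h; rewrite -EFinD lee_fin QE.
    have : delta / (t0 - z.2) <= e.
      rewrite ler_pdivrMr; last by rewrite subr_gt0.
      by rewrite ler_wpM2l ?(ltW e0)// /t0; lra.
    by have := Pe z; lra.
  move=> z bz; apply: limf_esup_max_le.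
    apply: limf_esup_past_max_le => //; first exact: ltW.
      move=> [cz _]; apply: le_trans (Wbd z cz) _; rewrite lee_fin.
      by have /andP[] := HA z bz.
    by apply: limf_esup_cst_le; exact: Kf.
  apply: (@le_trans _ _ (Q z)%:E).
    by apply: (@limf_esup_le_continuous _ _ _ _ Q) => //; exact: continuous_barrier.
  rewrite lee_fin; have [lt|/far QK] := ltP (sqdist z0 z) rho.
    have [/(_ bz)/andP[h _] _] := Hrho z lt.
    by rewrite QE; have := Pe z; lra.
  exact: le_trans QK (Kf z bz).
have cQ : {for z0, continuous Q} by exact: continuous_barrier.
have near : \forall z \near z0, f z0 - 5 * e < Q z.
  by apply: (cvgr_gt _ cQ); rewrite /Q barrier_self; lra.
apply/near_withinP; apply: filterS near => z Qz Gz.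
apply: le_trans (lower_perron_ge z Lv).
by rewrite le_max; apply/orP; right; rewrite lee_fin ltW.
Qed.

Lemma regular_of_before : regular_boundary_point G z0.
Proof.
split=> // f cf; apply/cvg_ereal_epsP => e e0.
have e50 : 0 < e / 5 by rewrite divr_gt0.
apply: filterS2 (near_perron_ge cf e50) (near_perron_le cf e50) => z h1 h2.
apply/andP; split.
  by apply: le_trans h1; rewrite lee_fin; lra.
by apply: le_trans h2 _; rewrite lee_fin; lra.
Qed.

End RegularityConverse.

Theorem theorem4p8 (R : realType) (n : nat) (n_gt0 : (0 < n)%N)
    (Omega : set ('rV[R]_n * R)%type)
    (Omega_open : open Omega) (Omega_connected : connected Omega)
    (Omega_nonempty : Omega !=set0) (Omega_bounded : bounded_set Omega)
    (x0 : 'rV[R]_n) (t0 : R) (z0_boundary : boundary Omega (x0, t0)) :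
  regular_boundary_point Omega (x0, t0) <->
  regular_boundary_point (before t0 Omega) (x0, t0) \/
  ~ boundary (before t0 Omega) (x0, t0).
Proof.
split=> [reg|]; last exact: (@regular_of_before _ _ _ _ (x0, t0)).
have [bz|nbz] := pselect (boundary (before t0 Omega) (x0, t0)); last by right.
by left; exact: (@regular_before _ _ _ _ (x0, t0)).
Qed.
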